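(* Let $u$, $\{u_{h_k}\}_{k\in\mathbb N_0}$, the sequence of interpolation operators $\{\mathcal I_{M_k}\}_{k\in\mathbb N_0}$, the multilevel approximation $u_K^{(\mathrm{ML})}$, and the costs $C_k$, $C^{(\mathrm{ML})}$ and $C^{(\mathrm{ML})}_\varepsilon$ be as described in the context. Suppose the following three assumptions hold. (i) There exist positive constants $\alpha$ and $C_s$, independent of $h_k$, such that for all $k\in\mathbb N_0$, $$\|u-u_{h_k}\|_{L^2_\rho(\Gamma;H^1_0(D))}\le C_s\,h_k^{\alpha}.$$ (ii) There exist positive constants $C_I,C_\zeta,\beta,\mu$ and a Banach space $\Lambda(\Gamma;H^1_0(D))\subset L^2_\rho(\Gamma;H^1_0(D))$ containing the finite element approximations $\{u_{h_k}\}_{k\in\mathbb N_0}$ such that for all $v\in\Lambda(\Gamma;H^1_0(D))$ and all $k\in\mathbb N_0$, $$\|v-\mathcal I_{M_k}v\|_{L^2_\rho(\Gamma;H^1_0(D))}\le C_I\,\sigma_k\,\zeta(v),$$ for some function $\zeta:\Lambda(\Gamma;H^1_0(D))\to\mathbb R$ and a decreasing sequence $\sigma_k$ that admit the estimates $$\zeta(u_{h_k})\le C_\zeta\,h_0^\beta\quad\text{and}\quad\zeta(u_{h_{k+1}}-u_{h_k})\le C_\zeta\,h_{k+1}^\beta;$$ and this holds with $\sigma_k=M_k^{-\mu}$. (iii) There exist positive constants $\gamma$ and $C_c$, independent of $h_k$, such that $C_k\le C_c\,h_k^{-\gamma}$ for all $k\in\mathbb N_0$. Assume further that $\alpha\ge\min(\beta,\mu\gamma)$.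 Then, for any $0<\varepsilon<\exp[-1]$, there exists an integer $K$ such that $$\|u-u_K^{(\mathrm{ML})}\|_{L^2_\rho(\Gamma;H^1_0(D))}\le\varepsilon$$ and $$C^{(\mathrm{ML})}_\varepsilon\lesssim\begin{cases}\varepsilon^{-\frac1\mu}, & \text{if }\beta>\mu\gamma,\\[1ex] \varepsilon^{-\frac1\mu}|\log\varepsilon|^{1+\frac1\mu}, & \text{if }\beta=\mu\gamma,\\[1ex] \varepsilon^{-\frac1\mu-\frac{\gamma\mu-\beta}{\alpha\mu}}, & \text{if }\beta<\mu\gamma.\end{cases}$$
   Context: Setting. $D\subset\mathbb R^d$ ($d=1,2,3$) is a bounded Lipschitz domain, $\Gamma=[-1,1]^N$ is the range of a random vector $\bm y=(y_1,\dots,y_N)$, and $\rho(\bm y)=\prod_{n=1}^N\widetilde\rho(y_n)\in L^\infty(\Gamma)$ is its joint probability density. The coefficient $a(\bm y,\mathbf x)$ satisfies, with probability one, $a_{\min}\le a(\bm y,\mathbf x)\le a_{\max}$ for all $\mathbf x\in\overline D$, where $0<a_{\min}$ and $a_{\max}<\infty$ are constants, and $f\in L^2_\rho(\Gamma;H^{-1}(D))$. The function $u\in L^2_\rho(\Gamma;H^1_0(D))$ is the unique solution of $-\nabla\cdot(a(\bm y,\mathbf x)\nabla u(\bm y,\mathbf x))=f(\bm y,\mathbf x)$ in $D$, $u(\bm y,\cdot)=0$ on $\partial D$, almost surely; it is assumed that $u\in C^0(\Gamma;H^1_0(D))$. The norm is $\|v\|^2_{L^2_\rho(\Gamma;H^1_0(D))}=\int_\Gamma\|v(\bm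 y,\cdot)\|_{H^1_0(D)}^2\,\rho(\bm y)\,\mathrm d\bm y$. Spatial approximation. $V_{h_0}\subset V_{h_1}\subset\dots\subset H^1_0(D)$ are nested finite element spaces; $V_{h_k}$ consists of continuous, piecewise polynomial functions on a shape-regular triangulation of $D$ with maximum mesh spacing $h_k=\eta^{-k}h_0$, for some $\eta\in\mathbb N$, $\eta>1$ (iterated uniform subdivision of an initial triangulation). $u_{h_k}(\bm y,\cdot)\in V_{h_k}$ is the Galerkin finite element approximation of $u(\bm y,\cdot)$. Set $u_{h_{-1}}:=0$. Interpolation. $\{\mathcal I_{M_k}\}_{k=0}^\infty$ is a sequence of interpolation operators $\mathcal I_{M_k}:C^0(\Gamma)\to L^2_\rho(\Gamma)$, where $\mathcal I_{M_k}$ uses $M_k$ points in $\Gamma$. Repetitions $M_{k+1}=M_k$, $\mathcal I_{M_{k+1}}=\mathcal I_{M_k}$, $\sigma_{k+1}=\sigma_k$ are allowed, so ''decreasing'' for $\sigma_k$ is meant in the non-strict sense. An operator $\mathcal I_M$ using points $\bm y_1,\dots,\bm y_M\in\Gamma$ is applied to functions $v$ on $\Gamma$ with values in $H^1_0(D)$ by $\mathcal I_M[v](\bm y,\mathbf x)=\sum_{m=1}^M c_m(\mathbf x)\phi_m(\bm y)$, where $\{\phi_m\}_{m=1}^M$ is a basis of an interpolation space contained in $L^2_\rho(\Gamma)$ and the coefficients $c_m$ are determined by $\mathcal I_M[v](\bm y_m,\mathbf x)=v(\bm y_m,\mathbf x)$, $m=1,\dots,M$. Multilevel approximation and cost. For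 $K\in\mathbb N$, $$u_K^{(\mathrm{ML})}:=\sum_{k=0}^K\mathcal I_{M_{K-k}}[u_{h_k}-u_{h_{k-1}}].$$ $C_k$ denotes the cost of computing $u_{h_k}-u_{h_{k-1}}$ at one sample point of $\Gamma$, and the total computational cost of the multilevel approximation is quantified by $C^{(\mathrm{ML})}=\sum_{k=0}^K M_{K-k}\,C_k$. The $\varepsilon$-cost $C^{(\mathrm{ML})}_\varepsilon$ is the computational cost, measured by $C^{(\mathrm{ML})}$, required to achieve the accuracy $\|u-u_K^{(\mathrm{ML})}\|_{L^2_\rho(\Gamma;H^1_0(D))}\le\varepsilon$. The notation $A\lesssim B$ means $A\le cB$ with a constant $c>0$ independent of $\varepsilon$.
   Formalization: Added: every m ≥ 1 can be rounded up, within a fixed factor, to some M_k; and for each ε the multilevel approximation (and the ε-cost) may use a nondecreasing re-indexing of the given operators. For a fixed sequence, e.g. M_k = 1 for all k, the claim is false. *)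

(* Defs.v *)
From HB Require Import structures.
From mathcomp Require Import all_boot all_order all_algebra.
From mathcomp Require Import all_classical all_reals all_analysis.
From mathcomp Require Import measurable_realfun.
From mathcomp Require Import ring.

Set Implicit Arguments.
Unset Strict Implicit.
Unset Printing Implicit Defensive.

Import Order.TTheory GRing.Theory Num.Theory.
Import numFieldNormedType.Exports.

Local Open Scope classical_set_scope.
Local Open Scope ring_scope.

Definition rV_display (n : nat) : measure_display.
Proof. exact: default_measure_display. Qed.

(* 'rV[R]_n carries the product sigma-algebra, which by open_measurable_rV below
   is the Borel sigma-algebra. *)
Section rV_measurable.
Variables (R : realType) (n : nat).

Definition rV_coord (i : 'I_n) (x : 'rV[R]_n) : R := x 0 i.

Let rV_set0 : g_sigma_preimage rV_coord set0.
Proof. exact: sigma_algebra0. Qed.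

Let rV_setC A : g_sigma_preimage rV_coord A -> g_sigma_preimage rV_coord (~` A).
Proof. exact: sigma_algebraC. Qed.

Let rV_bigcup (F : _^nat) : (forall i, g_sigma_preimage rV_coord (F i)) ->
  g_sigma_preimage rV_coord (\bigcup_i (F i)).
Proof. exact: sigma_algebra_bigcup. Qed.

HB.instance Definition _ := @isMeasurable.Build (rV_display n) 'rV[R]_n
  (g_sigma_preimage rV_coord) rV_set0 rV_setC rV_bigcup.

Lemma measurable_rV_coord i : measurable_fun setT (rV_coord i).
Proof.
move=> _ Y mY; rewrite setTI; apply: sub_sigma_algebra => /=.
rewrite -bigcup_seq/=; exists i => /=; first by rewrite mem_index_enum.
by exists Y => //; rewrite setTI.
Qed.

Lemma measurable_fun_rV d (T : measurableType d) (f : T -> 'rV[R]_n) :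
  (forall i, measurable_fun setT (fun x => f x 0 i)) -> measurable_fun setT f.
Proof.
move=> mf.
have H : g_sigma_preimage (fun i => rV_coord i \o f) `<=` measurable.
  apply: smallest_sub; first exact: sigma_algebra_measurable.
  move=> A; rewrite -bigcup_seq => -[i _ [B mB <-]].
  exact: mf.
move=> _ A mA.
have -> : [set: T] `&` f @^-1` A = f @^-1` A by rewrite setTI.
apply: H; rewrite g_sigma_preimage_comp.
by exists A => //; rewrite setTI.
Qed.

Lemma open_measurable_rV (U : set 'rV[R]_n) : open U -> measurable U.
Proof.
move=> oU.
pose box (q : {ffun 'I_n -> rat} * rat) : set 'rV[R]_n :=
  [set x | forall i, `|ratr (q.1 i) - x 0 i| < ratr q.2].
pose F q := if `[< box q `<=` U >] then box q else set0.
have -> : U = \bigcup_q F q.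
  apply/seteqP; split => [x Ux|x [q _]]; last first.
    by rewrite /F; case: ifP => // /asboolP; apply.
  have /nbhs_ballP[e /= e0 eU] : nbhs x U by exact: open_nbhs_nbhs.
  have [r] : exists r, (ratr r : R) \in `]0, (e / 2)[%R.
    by apply: rat_in_itvoo; rewrite divr_gt0.
  rewrite in_itv/= => /andP[r0 re].
  have : forall i : 'I_n, exists q : rat, `|ratr q - x 0 i| < ratr r.
    move=> i; have [q] : exists q, (ratr q : R) \in
        `](x 0 i - ratr r), (x 0 i + ratr r)[%R.
      by apply: rat_in_itvoo; rewrite ltrBlDr -addrA ltrDl addr_gt0.
    by rewrite in_itv/= => qx; exists q; rewrite ltr_distl.
  move=> /choice[q qx].
  exists ([ffun i => q i], r) => //; rewrite /F asboolT; last first.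
    move=> y yb; apply: eU; split => // i j.
    rewrite ord1 /ball/= (le_lt_trans (ler_distD (ratr (q j)) _ _))//.
    rewrite [ltRHS]splitr ltrD//; first by rewrite distrC (lt_trans (qx j)).
    by have := yb j; rewrite /= ffunE => /lt_trans; exact.
  by move=> i/=; rewrite ffunE.
apply: countable_bigcupT_measurable => [|q].
  exact: countableP.
rewrite /F; case: ifP => // _.
have -> : box q = \bigcap_(i in [set: 'I_n])
    (rV_coord i @^-1` [set t | `|ratr (q.1 i) - t| < ratr q.2]).
  by apply/seteqP; split => x /= xq i; [move=> _|]; apply: xq.
apply: fin_bigcap_measurable => // i _; rewrite -[X in measurable X]setTI.
apply: measurable_rV_coord => //.
have -> : [set t : R | `|ratr (q.1 i) - t| < ratr q.2] =
    ball (ratr (q.1 i) : R) (ratr q.2) by [].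
by apply: open_measurable; exact: ball_open.
Qed.

Lemma continuous_measurable_rV (f : 'rV[R]_n -> R) :
  continuous f -> measurable_fun setT f.
Proof.
move=> /continuousP cf; apply: (measurability _ (RGenOpens.measurableE R)).
move=> _ [_ [a [b ->] <-]]; rewrite setTI; apply: open_measurable_rV.
by apply: cf; exact: interval_open.
Qed.

End rV_measurable.

Section lebesgue_rV.
Variable R : realType.

Definition rV_cons n (p : R * 'rV[R]_n) : 'rV[R]_n.+1 :=
  \row_i oapp (fun j => p.2 0 j) p.1 (unlift ord0 i).

Definition rV_uncons n (x : 'rV[R]_n.+1) : R * 'rV[R]_n :=
  (x 0 ord0, \row_j x 0 (lift ord0 j)).

Lemma rV_consK n : cancel (@rV_cons n) (@rV_uncons n).
Proof.
case=> a x; rewrite /rV_uncons /rV_cons /= mxE unlift_none /=; congr (_, _).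
by apply/rowP => j; rewrite !mxE liftK.
Qed.

Lemma measurable_rV_cons n : measurable_fun setT (@rV_cons n).
Proof.
apply: measurable_fun_rV => i; case: (unliftP ord0 i) => [j ->|->].
  under eq_fun do rewrite mxE liftK /=.
  exact: (measurableT_comp (measurable_rV_coord j)).
under eq_fun do rewrite mxE unlift_none /=.
exact: measurable_fst.
Qed.

Lemma measurable_rV_uncons n : measurable_fun setT (@rV_uncons n).
Proof.
apply: measurable_fun_pair => /=; first exact: (measurable_rV_coord ord0).
apply: measurable_fun_rV => i /=.
under eq_fun do rewrite mxE.
exact: (measurable_rV_coord (lift ord0 i)).
Qed.

Section succ.
Variables (n : nat) (m : {sigma_finite_measure set 'rV[R]_n -> \bar R}).
Local Open Scope ereal_scope.

Definition lebesgue_succ : set 'rV[R]_n.+1 -> \bar R :=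
  pushforward ((@lebesgue_measure R) \x m) (@rV_cons n).

Let mpre A : measurable A -> measurable (@rV_cons n @^-1` A).
Proof. by move=> mA; rewrite -[X in measurable X]setTI; exact: measurable_rV_cons. Qed.

Let lebesgue_succ0 : lebesgue_succ set0 = 0.
Proof. by rewrite /lebesgue_succ /pushforward preimage_set0 measure0. Qed.

Let lebesgue_succ_ge0 A : 0 <= lebesgue_succ A.
Proof. by apply: integral_ge0 => *; exact: measure_ge0. Qed.

Let lebesgue_succ_sigma_additive : semi_sigma_additive lebesgue_succ.
Proof.
move=> F mF tF mUF; rewrite /lebesgue_succ /pushforward preimage_bigcup.
apply: measure_semi_sigma_additive.
- by move=> k; exact: mpre.
- apply/trivIsetP => /= i j _ _ ij; rewrite -preimage_setI.
  by move/trivIsetP : tF => /(_ _ _ _ _ ij) ->//; rewrite preimage_set0.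
- by rewrite -preimage_bigcup; exact: mpre.
Qed.

HB.instance Definition _ := isMeasure.Build _ _ _ lebesgue_succ
  lebesgue_succ0 lebesgue_succ_ge0 lebesgue_succ_sigma_additive.

Let lebesgue_succ_sigma_finite : sigma_finite setT lebesgue_succ.
Proof.
pose l1 : {sigma_finite_measure set (measurableTypeR R) -> \bar R} :=
  @lebesgue_measure R.
have /sigma_finiteP[F [UF ndF Foo]] := sigma_finiteT l1.
have /sigma_finiteP[G [UG ndG Goo]] := sigma_finiteT m.
exists (fun k => @rV_uncons n @^-1` (F k `*` G k)).
  rewrite -preimage_bigcup; apply/esym/seteqP; split => // x _.
  have [i _ Fi] : (\bigcup_i F i) (rV_uncons x).1 by rewrite -UF.
  have [j _ Gj] : (\bigcup_i G i) (rV_uncons x).2 by rewrite -UG.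
  exists (maxn i j) => //; split.
  - by move: Fi; exact/subsetPset/ndF/leq_maxl.
  - by move: Gj; exact/subsetPset/ndG/leq_maxr.
move=> k; have [mF Fk] := Foo k; have [mG Gk] := Goo k; split.
  rewrite -[X in measurable X]setTI; apply: measurable_rV_uncons => //.
  exact: measurableX.
rewrite /lebesgue_succ /pushforward -comp_preimage.
rewrite (_ : _ \o _ = id) ?preimage_id//; last first.
  by apply/funext => p /=; exact: rV_consK.
rewrite [X in X < _](product_measure1E l1 m)//.
by rewrite lte_mul_pinfty// ge0_fin_numE.
Qed.

HB.instance Definition _ := Measure_isSigmaFinite.Build _ _ _ lebesgue_succ
  lebesgue_succ_sigma_finite.

End succ.

Fixpoint lebesgue_rV (n : nat) : {sigma_finite_measure set 'rV[R]_n -> \bar R} :=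
  match n with
  | 0 => \d_(0 : 'rV[R]_0)
  | n'.+1 => lebesgue_succ (lebesgue_rV n')
  end.

End lebesgue_rV.

Section test_functions.
Variables (R : realType) (d : nat) (D : set 'rV[R]_d).
Local Notation X := 'rV[R]_d.

Definition partial (i : 'I_d) (f : X -> R) : X -> R :=
  fun x => 'D_(delta_mx 0 i) f x.

Definition smooth (f : X -> R) := forall s : seq 'I_d,
  let g := foldr partial f s in
  continuous g /\ forall i x, derivable g x (delta_mx 0 i).

Definition test_function (f : X -> R) :=
  smooth f /\
  exists K, [/\ compact K, K `<=` D & forall x, ~ K x -> f x = 0].

Local Notation lin a f g := (fun x => a * f x + g x).

Let partial_lin (a : R) f g i : (forall x, derivable f x (delta_mx 0 i)) ->
  (forall x, derivable g x (delta_mx 0 i)) ->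
  partial i (lin a f g) = lin a (partial i f) (partial i g).
Proof.
move=> df dg; apply/funext => x; rewrite /partial.
rewrite (_ : (fun y => a * f y + g y) = (a *: f) + g)//.
rewrite deriveD//; last exact: derivableZ.
by rewrite deriveZ.
Qed.

Let foldr_partial_lin (a : R) f g s : smooth f -> smooth g ->
  foldr partial (lin a f g) s =
  lin a (foldr partial f s) (foldr partial g s).
Proof.
move=> sf sg; elim: s => //= i s ->; apply: partial_lin.
  by have [] := sf s.
by have [] := sg s.
Qed.

Lemma partial_test_lin (a : R) f g i : test_function f -> test_function g ->
  partial i (lin a f g) = lin a (partial i f) (partial i g).
Proof. by move=> [sf _] [sg _]; exact: (foldr_partial_lin a [:: i]). Qed.

Lemma test_function_lin (a : R) f g :
  test_function f -> test_function g -> test_function (lin a f g).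
Proof.
move=> [sf [K [cK KD Kf]]] [sg [L [cL LD Lg]]]; split.
  move=> s; rewrite foldr_partial_lin//=.
  have [cf df] := sf s; have [cg dg] := sg s; split.
    move=> x; apply: (@continuousD _ _ _ (fun y => a * foldr partial f s y)).
      by apply: (@continuousM _ _ (cst a)); [exact: cst_continuous|exact: cf].
    exact: cg.
  move=> i x; rewrite (_ : (fun y => a * foldr partial f s y + foldr partial g s y) =
    (a *: foldr partial f s) + foldr partial g s)//.
  by apply: derivableD => //; exact: derivableZ.
exists (K `|` L); split; first exact: compactU.
  by move=> x [/KD|/LD].
by move=> x /not_orP[/Kf fx /Lg gx]; rewrite fx gx mulr0 addr0.
Qed.

Lemma test_function0 : test_function (fun=> 0).
Proof.
split; last by exists set0; split => //; exact: compact0.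
move=> s; suff -> : foldr partial (fun=> 0) s = cst 0.
  by split => [x|i x]; [exact: cst_continuous|exact: derivable_cst].
elim: s => //= i s ->; apply/funext => x.
by rewrite /partial derive_cst.
Qed.

Lemma test_function_measurable f : test_function f -> measurable_fun setT f.
Proof.
by move=> [sf _]; apply: continuous_measurable_rV; have [] := sf [::].
Qed.

Lemma partial_test_measurable f i :
  test_function f -> measurable_fun setT (partial i f).
Proof.
by move=> [sf _]; apply: continuous_measurable_rV; have [] := sf [:: i].
Qed.

End test_functions.

Section h10_pair.
Variables (R : realType) (d : nat) (D : set 'rV[R]_d).
Local Notation X := 'rV[R]_d.
Local Notation mu := (@lebesgue_rV R d).

Definition L2dist (u f : X -> R) : \bar R :=
  'N[mu]_2%:E[EFin \o (fun x => u x - f x)%R]%E.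

Definition gpair := ((X -> R) * ('I_d -> X -> R))%type.

(* Closure of {(f, grad f) : f a test function on D} in L^2 x (L^2)^d.
   Functions on D are extended by zero, so integrals over the whole space are
   integrals over D for test functions, hence also for their limits. *)
Definition h10_graph (p : gpair) : Prop :=
  [/\ p.1 \in Lfun mu 2%:E,
      forall i, p.2 i \in Lfun mu 2%:E &
      forall e : R, 0 < e -> exists f,
        [/\ test_function D f,
            (L2dist p.1 f <= e%:E)%E &
            forall i, (L2dist (p.2 i) (partial i f) <= e%:E)%E]].

Definition in_h10_graph : {pred gpair} := [pred p | `[< h10_graph p >]].

Let Nlin (a : R) (u v f g : X -> R) (e : R) :
  measurable_fun setT u -> measurable_fun setT v ->
  measurable_fun setT f -> measurable_fun setT g -> 0 < e ->
  (L2dist u f <= (e / 2 / (`|a| + 1))%:E)%E ->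
  (L2dist v g <= (e / 2)%:E)%E ->
  (L2dist (fun x => a * u x + v x)%R (fun x => a * f x + g x)%R <= e%:E)%E.
Proof.
rewrite /L2dist => mu_ mv mf mg e0 uf vg.
have a1 : 0 < `|a| + 1 by rewrite ltr_wpDl.
have Lw : (fun x => u x - f x) \in Lfun mu 2%:E.
  apply/andP; split; rewrite inE/=; first exact: measurable_funB.
  by rewrite /finite_norm (le_lt_trans uf)// ltry.
have [w wE] : exists w : LfunType mu (lee1n 2 : (1 <= 2%:E :> \bar R)%E),
    (w : X -> R) = (fun x => u x - f x).
  by exists (Lfun_Sub _ Lw); exact: Lfun_valP.
have -> : (fun x => (a * u x + v x) - (a * f x + g x)) =
    ((a \*: (w : X -> R)) \+ (fun x => v x - g x))%R.
  rewrite wE; apply/funext => x /=.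
  by rewrite /GRing.scale/= mulrBr opprD addrACA.
apply: (le_trans (minkowski_EFin _ _ _ _)) => //; rewrite ?ler1n//.
- by apply: measurable_funM => //; rewrite wE; exact: measurable_funB.
- exact: measurable_funB.
rewrite [X in (_ <= X%:E)%E](splitr e) [in leRHS]EFinD; apply: leeD => //.
rewrite (LnormZ w a) wE.
apply: (@le_trans _ _ (`|a|%:E * (e / 2 / (`|a| + 1))%:E)%E).
  by rewrite lee_wpmul2l// lee_fin.
rewrite -EFinM lee_fin mulrCA; apply: ler_piMr; first by rewrite divr_ge0 ?ltW.
by rewrite ler_pdivrMr// mul1r lerDl.
Qed.

Let Lfun2_0 : (fun=> 0 : R) \in Lfun mu 2%:E.
Proof. by have [] := Lfun_submod_closed mu (lee1n 2 : (1 <= 2%:E :> \bar R)%E). Qed.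

Let Lfun2_lin a (u v : X -> R) : u \in Lfun mu 2%:E -> v \in Lfun mu 2%:E ->
  (fun x => a * u x + v x) \in Lfun mu 2%:E.
Proof.
have [_ H] := Lfun_submod_closed mu (lee1n 2 : (1 <= 2%:E :> \bar R)%E).
exact: H.
Qed.

Lemma h10_graph_submod : submod_closed in_h10_graph.
Proof.
split.
  apply/asboolP; split => [|i|e e0]; [exact: Lfun2_0|exact: Lfun2_0|].
  rewrite /L2dist; exists (fun=> 0); split; first exact: test_function0.
    rewrite (_ : _ \o _ = cst 0%E) ?Lnorm0 ?lee_fin ?ltW//.
    by apply/funext => x /=; rewrite subr0.
  move=> i; rewrite (_ : _ \o _ = cst 0%E) ?Lnorm0 ?lee_fin ?ltW//.
  by apply/funext => x /=; rewrite /partial derive_cst subr0.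
move=> a p q /asboolP[p1 p2 pE] /asboolP[q1 q2 qE]; apply/asboolP.
have mLfun (h : X -> R) : h \in Lfun mu 2%:E -> measurable_fun setT h.
  by move=> /andP[]; rewrite inE.
split => [|i|e e0]; [exact: (Lfun2_lin a p1 q1)|exact: (Lfun2_lin a (p2 i) (q2 i))|].
have a1 : 0 < `|a| + 1 by rewrite ltr_wpDl.
have [|f [tf f1 f2]] := pE (e / 2 / (`|a| + 1)); first by rewrite !divr_gt0.
have [|g [tg g1 g2]] := qE (e / 2); first by rewrite divr_gt0.
exists (fun x => a * f x + g x); split; first exact: test_function_lin.
  have mf := test_function_measurable tf; have mg := test_function_measurable tg.
  by apply: (@Nlin a p.1 q.1) => //; exact: mLfun.
move=> i; rewrite (@partial_test_lin _ _ D)//.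
have mf := partial_test_measurable i tf.
have mg := partial_test_measurable i tg.
exact: (Nlin (mLfun _ (p2 i)) (mLfun _ (q2 i)) mf mg e0 (f2 i) (g2 i)).
Qed.

HB.instance Definition _ :=
  GRing.isSubmodClosed.Build R gpair in_h10_graph h10_graph_submod.

Record h10_pair := H10Pair { h10_val : gpair; _ : h10_val \in in_h10_graph }.

HB.instance Definition _ := [isSub for h10_val].
HB.instance Definition _ := [Choice of h10_pair by <:].
HB.instance Definition _ := [SubChoice_isSubLmodule of h10_pair by <:].
End h10_pair.

Section h10_dot.
Variables (R : realType) (d : nat) (D : set 'rV[R]_d).
Local Notation mu := (@lebesgue_rV R d).
Local Notation P := (h10_pair D).
Implicit Types p q r : P.

Definition pair_dot p q : R :=
  \sum_(i < d) \int[mu]_x ((\val p).2 i x * (\val q).2 i x).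

Let L2 p i : (\val p).2 i \in Lfun mu 2%:E.
Proof. by have /asboolP[] := valP p. Qed.

Let intM p q i :
  mu.-integrable setT (EFin \o (fun x => (\val p).2 i x * (\val q).2 i x)).
Proof. by apply/Lfun1_integrable; exact: (Lfun2_mul_Lfun1 (L2 p i) (L2 q i)). Qed.

Lemma pair_dotC p q : pair_dot p q = pair_dot q p.
Proof.
apply: eq_bigr => i _; apply: eq_Rintegral => x _.
by rewrite mulrC.
Qed.

Lemma pair_dot_ge0 p : 0 <= pair_dot p p.
Proof.
apply: sumr_ge0 => i _; apply: Rintegral_ge0 => x _.
by rewrite -expr2 sqr_ge0.
Qed.

Lemma pair_dotl a p q r :
  pair_dot (a *: p + q) r = a * pair_dot p r + pair_dot q r.
Proof.
rewrite /pair_dot mulr_sumr -big_split/=; apply: eq_bigr => i _.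
rewrite -RintegralZl//; last exact: intM.
rewrite -RintegralD//; last exact: intM.
  by apply: eq_Rintegral => x _; rewrite [in RHS]mulrA -[in RHS]mulrDl.
have := intM (a *: p) r i.
by apply: eq_integrable => // x _ /=; rewrite [in RHS]mulrA.
Qed.

Let pair_dotr a p q r :
  pair_dot r (a *: p + q) = a * pair_dot r p + pair_dot r q.
Proof. by rewrite pair_dotC pair_dotl ![pair_dot _ r]pair_dotC. Qed.

Let dotsq a p q : pair_dot (a *: p + q) (a *: p + q) =
  a ^+ 2 * pair_dot p p + 2 * a * pair_dot p q + pair_dot q q.
Proof. rewrite pair_dotl !pair_dotr (pair_dotC q p); ring. Qed.

Let dot0 p q : pair_dot p p = 0 -> pair_dot p q = 0.
Proof.
move=> p0; apply/eqP/negPn/negP => pq0.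
have := pair_dot_ge0 ((- (pair_dot q q + 1) / (2 * pair_dot p q)) *: p + q).
rewrite dotsq p0 mulr0 add0r leNgt => /negP; apply.
rewrite (_ : _ + _ = -1) ?ltrN10//; by field.
Qed.

Lemma pair_CauchySchwarz p q :
  (pair_dot p q) ^+ 2 <= pair_dot p p * pair_dot q q.
Proof.
have [p0|p0] := eqVneq (pair_dot p p) 0.
  by rewrite (dot0 q p0) p0 expr0n mul0r.
have pp : 0 < pair_dot p p by rewrite lt_neqAle eq_sym p0 pair_dot_ge0.
have := pair_dot_ge0 ((- (pair_dot p q / pair_dot p p)) *: p + q).
rewrite dotsq -(pmulr_rge0 _ pp) -[in X in _ -> X]subr_ge0.
by set l := (X in 0 <= X -> _); set r := (X in _ -> 0 <= X);
  rewrite (_ : l = r)// /l /r; field.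
Qed.

Definition pair_norm p : R := Num.sqrt (pair_dot p p).

Lemma pair_norm_ge0 p : 0 <= pair_norm p. Proof. exact: sqrtr_ge0. Qed.

Lemma pair_normD p q : pair_norm (p + q) <= pair_norm p + pair_norm q.
Proof.
rewrite -(ler_pXn2r (ltn0Sn 1)) ?nnegrE ?addr_ge0 ?pair_norm_ge0//.
rewrite sqr_sqrtr ?pair_dot_ge0// sqrrD !sqr_sqrtr ?pair_dot_ge0//.
rewrite -[p in leLHS]scale1r dotsq expr1n mul1r mulr1.
rewrite lerD2r lerD2l -[leRHS]mulr_natl ler_pM2l//.
rewrite -sqrtrM ?pair_dot_ge0//.
rewrite (le_trans (ler_norm _))// -sqrtr_sqr ler_wsqrtr//.
exact: pair_CauchySchwarz.
Qed.

Lemma pair_normZ a p : pair_norm (a *: p) = `|a| * pair_norm p.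
Proof.
rewrite /pair_norm -[a *: p]addr0 dotsq (pair_dotC p 0).
have z : pair_dot 0 0 = 0.
  rewrite /pair_dot big1// => i _.
  by under eq_Rintegral do rewrite /= mul0r; rewrite Rintegral_cst// mul0r.
by rewrite (dot0 _ z) z mulr0 !addr0 sqrtrM ?sqr_ge0// sqrtr_sqr.
Qed.

Definition pair_null : {pred P} := [pred p | pair_norm p == 0].

Lemma pair_null_zmod : zmod_closed pair_null.
Proof.
split; first by rewrite inE -(scale0r 0) pair_normZ normr0 mul0r.
move=> p q; rewrite !inE => /eqP p0 /eqP q0.
rewrite eq_le pair_norm_ge0 andbT (le_trans (pair_normD _ _))//.
by rewrite p0 -scaleN1r pair_normZ q0 mulr0 addr0.
Qed.

HB.instance Definition _ := GRing.isZmodClosed.Build P pair_null pair_null_zmod.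

End h10_dot.

Section h10.
Variables (R : realType) (d : nat) (D : set 'rV[R]_d).
Local Notation P := (h10_pair D).

(* H^1_0(D) with the norm |v| = ||grad v||_{L^2(D)}, as the quotient of pairs
   (v, grad v) by the null space of this seminorm.  For bounded D the Poincare
   inequality makes this null space the space of pairs vanishing almost
   everywhere. *)
Definition H10 := Quotient.quot (@pair_null R d D : zmodClosed P).

HB.instance Definition _ := GRing.Zmodule.on H10.
HB.instance Definition _ := EqQuotient.on H10.

Local Open Scope quotient_scope.
Implicit Types v w : H10.

Let reprE (p : P) : exists2 n : P, pair_norm n = 0 & repr (\pi_H10 p) = p + n.
Proof.
exists (repr (\pi_H10 p) - p); last by rewrite addrC subrK.
have : repr (\pi_H10 p) == p %[mod H10] by rewrite reprK.
by rewrite -Quotient.idealrBE inE => /eqP.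
Qed.

Let piE (p q : P) : pair_norm (p - q) = 0 -> \pi_H10 p = \pi_H10 q.
Proof. by move=> pq; apply/eqP; rewrite -Quotient.idealrBE inE pq. Qed.

Definition h10_scale (a : R) v : H10 := \pi_H10 (a *: repr v).

Let pi_scale a p : h10_scale a (\pi_H10 p) = \pi_H10 (a *: p).
Proof.
rewrite /h10_scale; have [n n0 ->] := reprE p; apply: piE.
by rewrite scalerDr addrAC subrr add0r pair_normZ n0 mulr0.
Qed.

Let piP v : exists p, v = \pi_H10 p.
Proof. by exists (repr v); rewrite reprK. Qed.

Let piD (p q : P) : \pi_H10 (p + q) = \pi_H10 p + \pi_H10 q.
Proof. exact: Quotient.pi_add. Qed.

Let scaleA a b v : h10_scale a (h10_scale b v) = h10_scale (a * b) v.
Proof. by have [p ->] := piP v; rewrite !pi_scale scalerA. Qed.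

Let scale1 : left_id 1 h10_scale.
Proof. by move=> v; have [p ->] := piP v; rewrite pi_scale scale1r. Qed.

Let scaleDr : right_distributive h10_scale +%R.
Proof.
move=> a v w; have [p ->] := piP v; have [q ->] := piP w.
by rewrite -piD !pi_scale scalerDr piD.
Qed.

Let scaleDl v : {morph h10_scale^~ v : a b / a + b}.
Proof. by move=> a b /=; have [p ->] := piP v; rewrite !pi_scale scalerDl piD. Qed.

HB.instance Definition _ :=
  GRing.Zmodule_isLmodule.Build R H10 scaleA scale1 scaleDr scaleDl.

Definition h10_norm v : R := pair_norm (repr v).

Lemma h10_normE p : h10_norm (\pi_H10 p) = pair_norm p.
Proof.
rewrite /h10_norm; have [n n0 ->] := reprE p; apply/eqP; rewrite eq_le.
rewrite (le_trans (pair_normD _ _)) ?n0 ?addr0//=.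
rewrite -[p in leLHS](addrK n) (le_trans (pair_normD _ _))//.
by rewrite -scaleN1r pair_normZ n0 mulr0 addr0.
Qed.

Let normD v w : h10_norm (v + w) <= h10_norm v + h10_norm w.
Proof.
have [p ->] := piP v; have [q ->] := piP w.
by rewrite -piD !h10_normE pair_normD.
Qed.

Let normZ a v : h10_norm (a *: v) = `|a| * h10_norm v.
Proof.
have [p ->] := piP v; rewrite (_ : _ *: _ = \pi_H10 (a *: p)); last exact: pi_scale.
by rewrite !h10_normE pair_normZ.
Qed.

Let norm0_eq0 v : h10_norm v = 0 -> v = 0.
Proof.
have [p ->] := piP v; rewrite h10_normE => v0.
have -> : (0 : H10) = \pi_H10 0 by apply: (addIr (\pi_H10 0)); rewrite -piD !add0r.
by apply: piE; rewrite subr0.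
Qed.

HB.instance Definition _ := @Lmodule_isNormed.Build R H10
  h10_norm normD normZ norm0_eq0.

Definition h10_fun v : 'rV[R]_d -> R := (\val (repr v)).1.
Definition h10_grad v : 'I_d -> 'rV[R]_d -> R := (\val (repr v)).2.

End h10.

Section geometry.
Variables (R : realType) (d : nat).
Local Notation X := 'rV[R]_d.

Definition edot (x y : X) : R := \sum_i x 0 i * y 0 i.
Definition enorm (x : X) : R := Num.sqrt (edot x x).

(* Near each boundary point, D is the strict epigraph, in the unit direction e,
   of a Lipschitz function of the coordinates orthogonal to e; psi is extended
   to the whole space by being constant along e. *)
Definition lipschitz_boundary (D : set X) : Prop :=
  forall x, (closure D `\` D°) x ->
  exists r : R, exists L : R, exists e : X, exists psi : X -> R,
    [/\ 0 < r, enorm e = 1,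
        forall y z, `|psi y - psi z| <= L * enorm (y - z),
        forall z t, psi (z + t *: e) = psi z &
        forall z, enorm (z - x) < r -> (D z <-> psi z < edot z e)].

Definition bounded_lipschitz_domain (D : set X) : Prop :=
  [/\ open D, connected D, D !=set0, bounded_set D & lipschitz_boundary D].

(* A simplex is given by the matrix whose rows are its d+1 vertices. *)
Definition simplex := 'M[R]_(d.+1, d).

Definition nondegenerate (T : simplex) : bool :=
  row_free (row_mx T (const_mx 1 : 'cV[R]_d.+1)).

Definition barycentric (l : 'rV[R]_d.+1) : Prop :=
  (forall i, 0 <= l 0 i) /\ \sum_i l 0 i = 1.

Definition hull (T : simplex) : set X :=
  [set x | exists2 l, barycentric l & x = l *m T].

Definition common_face (T T' : simplex) : set X :=
  [set x | exists l, [/\ barycentric l, x = l *m T &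
    forall i, l 0 i != 0 -> exists j, row i T = row j T']].

Definition triangulation (D : set X) (TT : seq simplex) : Prop :=
  [/\ forall T, T \in TT -> nondegenerate T,
      closure D = [set x | exists2 T, T \in TT & hull T x] &
      forall T T', T \in TT -> T' \in TT ->
        hull T `&` hull T' `<=` common_face T T'].

Definition diam (A : set X) : R :=
  sup [set r | exists x y, [/\ A x, A y & r = enorm (x - y)]].

Definition inradius (A : set X) : R :=
  sup [set r | 0 <= r /\ exists x, [set y | enorm (y - x) <= r] `<=` A].

Definition shape_regular (TT : nat -> seq simplex) : Prop :=
  exists2 kappa : R, 0 < kappa & forall k T, T \in TT k ->
    diam (hull T) <= kappa * inradius (hull T).

Definition mesh_size (TT : seq simplex) (h : R) : Prop :=
  (forall T, T \in TT -> diam (hull T) <= h) /\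
  exists2 T, T \in TT & diam (hull T) = h.

Definition refines (TT' TT : seq simplex) : Prop :=
  forall T', T' \in TT' -> exists2 T, T \in TT & hull T' `<=` hull T.

Definition mpolynomial (r : nat) (c : {ffun 'I_d -> 'I_r.+1} -> R) (x : X) : R :=
  \sum_m c m * \prod_i x 0 i ^+ m i.

Definition piecewise_polynomial (TT : seq simplex) (r : nat) (w : X -> R) :=
  forall T, T \in TT -> exists c : {ffun 'I_d -> 'I_r.+1} -> R,
    forall x, hull T x -> w x = mpolynomial c x.

Definition fe_space (D : set X) (TT : seq simplex) (V : set (H10 D)) : Prop :=
  [/\ V 0, forall (a : R) v w, V v -> V w -> V (a *: v + w) &
      exists r, forall v, V v -> exists w : X -> R,
        [/\ {within closure D, continuous w}, piecewise_polynomial TT r w &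
            {ae @lebesgue_rV R d, forall x, D x -> h10_fun v x = w x}]].

End geometry.

Section parameter_space.
Variables (R : realType) (N : nat).
Local Notation Y := 'rV[R]_N.

Definition Gamma : set Y := [set y | forall n, -1 <= y 0 n <= 1].

Definition probability_density (rho1 : R -> R) : Prop :=
  [/\ forall t, 0 <= rho1 t, measurable_fun setT rho1 &
      (\int[lebesgue_measure]_(t in `[(-1)%R, 1%R]) (rho1 t)%:E = 1)%E].

Definition joint_density (rho1 : R -> R) (y : Y) : R :=
  \prod_(n < N) rho1 (y 0 n).

Definition essentially_bounded (rho : Y -> R) : Prop :=
  exists B : R, {ae @lebesgue_rV R N, forall y, Gamma y -> `|rho y| <= B}.

Variable rho : Y -> R.

(* P holds almost everywhere for the measure rho dy on Gamma. *)
Definition almost_surely (P : Y -> Prop) : Prop :=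
  {ae @lebesgue_rV R N, forall y, Gamma y -> 0 < rho y -> P y}.

Section bochner.
Variables (V : lmodType R) (B : set V) (nrm : V -> R).

Definition simple_map (s : Y -> V) : Prop :=
  exists m (A : 'I_m -> set Y) (b : 'I_m -> V),
    [/\ forall i, measurable (A i), forall i, B (b i) &
        forall y, s y = \sum_i (\1_(A i) y : R) *: b i].

Definition strongly_measurable (v : Y -> V) : Prop :=
  exists s : nat -> Y -> V, (forall n, simple_map (s n)) /\
    almost_surely (fun y => (fun n => nrm (s n y - v y)) @ \oo --> (0 : R)).

Definition L2rho_norm_of (v : Y -> V) : \bar R :=
  ((\int[@lebesgue_rV R N]_(y in Gamma) (nrm (v y) ^+ 2 * rho y)%:E)
    `^ (2^-1))%E.

(* L^2_rho(Gamma; B) for a linear subspace B of V on which nrm is a norm. *)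
Definition L2rho_of (v : Y -> V) : Prop :=
  [/\ forall y, Gamma y -> B (v y), strongly_measurable v &
      (L2rho_norm_of v < +oo)%E].

End bochner.

Definition L2rho_norm (E : normedModType R) (v : Y -> E) : \bar R :=
  L2rho_norm_of Num.norm v.
Definition L2rho (E : normedModType R) (v : Y -> E) : Prop :=
  L2rho_of setT Num.norm v.

Record interpolation (M : nat) := Interpolation {
  node : 'I_M -> Y;
  basis_fun : 'I_M -> Y -> R }.

Definition collocation_mx M (I : interpolation M) : 'M[R]_M :=
  \matrix_(l, m) basis_fun I m (node I l).

Definition interpolation_operator M (I : interpolation M) : Prop :=
  [/\ forall m, Gamma (node I m), forall m, L2rho (basis_fun I m) &
      collocation_mx I \in unitmx].

Definition interp_coef (E : lmodType R) M (I : interpolation M) (v : Y -> E)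
    (m : 'I_M) : E :=
  \sum_l invmx (collocation_mx I) m l *: v (node I l).

Definition interp (E : lmodType R) M (I : interpolation M) (v : Y -> E) : Y -> E :=
  fun y => \sum_m basis_fun I m y *: interp_coef I v m.

Lemma interpP (E : lmodType R) M (I : interpolation M) (v : Y -> E) l :
  interpolation_operator I -> interp I v (node I l) = v (node I l).
Proof.
move=> [_ _ uI]; rewrite /interp /interp_coef.
under eq_bigr do rewrite scaler_sumr.
rewrite exchange_big/= (bigD1 l)//= [X in _ + X]big1 ?addr0 => [|j jl].
  under eq_bigr do rewrite scalerA.
  rewrite -scaler_suml -[RHS]scale1r; congr (_ *: _).
  have /matrixP/(_ l l) := mulmxV uI; rewrite !mxE eqxx => H; apply: etrans H.
  by apply: eq_bigr => m _; rewrite mxE.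
under eq_bigr do rewrite scalerA.
rewrite -scaler_suml -[RHS](scale0r (v (node I j))); congr (_ *: _).
have /matrixP/(_ l j) := mulmxV uI; rewrite !mxE eq_sym (negbTE jl) => H; apply: etrans H.
by apply: eq_bigr => m _; rewrite mxE.
Qed.

(* The interpolation conditions determine the coefficients. *)
Lemma interp_coef_unique (E : lmodType R) M (I : interpolation M) (v : Y -> E)
    (c : 'I_M -> E) : interpolation_operator I ->
  (forall l, \sum_m basis_fun I m (node I l) *: c m = v (node I l)) ->
  c =1 interp_coef I v.
Proof.
move=> [_ _ uI] cv m; rewrite /interp_coef.
under eq_bigr do rewrite -cv scaler_sumr.
rewrite exchange_big/= (bigD1 m)//= [X in _ + X]big1 ?addr0 => [|j jm].
  under eq_bigr do rewrite scalerA.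
  rewrite -scaler_suml -[LHS]scale1r; congr (_ *: _).
  have /matrixP/(_ m m) := mulVmx uI; rewrite !mxE eqxx => H; apply/esym/(etrans _ H).
  by apply: eq_bigr => l _; rewrite mxE.
under eq_bigr do rewrite scalerA.
rewrite -scaler_suml -[RHS](scale0r (c j)); congr (_ *: _).
have /matrixP/(_ m j) := mulVmx uI; rewrite !mxE eq_sym (negbTE jm) => H; apply: etrans H.
by apply: eq_bigr => l _; rewrite mxE.
Qed.

End parameter_space.

Section diffusion.
Variables (R : realType) (d N : nat) (D : set 'rV[R]_d).

Definition dual_space : set (H10 D -> R) :=
  [set l : H10 D -> R | scalar l /\ continuous l].

Definition dual_norm (l : H10 D -> R) : R :=
  sup [set `|l v| | v in [set v : H10 D | `|v| <= 1]].

Definition diffusion_form (a : 'rV[R]_d -> R) (v w : H10 D) : R :=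
  \int[@lebesgue_rV R d]_(x in D)
    (a x * \sum_i h10_grad v i x * h10_grad w i x).

(* With W the whole space: the weak formulation of the boundary value problem;
   with W a finite element space: the Galerkin equations. *)
Definition variational_solution (rho : 'rV[R]_N -> R) (W : set (H10 D))
    (a : 'rV[R]_N -> 'rV[R]_d -> R) (f : 'rV[R]_N -> H10 D -> R)
    (u : 'rV[R]_N -> H10 D) : Prop :=
  (forall y, Gamma y -> W (u y)) /\
  almost_surely rho (fun y =>
    forall w, W w -> diffusion_form (a y) (u y) w = f y w).

End diffusion.

Section multilevel.
Variables (R : realType) (N : nat) (E : normedModType R).
Variables (rho : 'rV[R]_N -> R) (u : 'rV[R]_N -> E) (uh : nat -> 'rV[R]_N -> E).
Variables (M : nat -> nat) (I : forall k, interpolation R N (M k)).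
Variable C : nat -> R.

Definition level_difference (k : nat) : 'rV[R]_N -> E :=
  fun y => uh k y - (if k is k'.+1 then uh k' y else 0).

(* l k is the position, in the given sequence of operators, of the operator
   used as the k-th one by the multilevel approximation. *)
Definition multilevel (l : nat -> nat) (K : nat) : 'rV[R]_N -> E :=
  fun y => \sum_(k < K.+1) interp (I (l (K - k)%N)) (level_difference k) y.

Definition multilevel_error (l : nat -> nat) (K : nat) : \bar R :=
  L2rho_norm rho (fun y => u y - multilevel l K y).

Definition multilevel_cost (l : nat -> nat) (K : nat) : R :=
  \sum_(k < K.+1) (M (l (K - k)%N))%:R * C k.

Definition eps_cost (eps : R) : \bar R :=
  ereal_inf [set c | exists l K, [/\ {homo l : i j / (i <= j)%N},
    (multilevel_error l K <= eps%:E)%E & c = (multilevel_cost l K)%:E]].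

End multilevel.

(* Any number of points can be rounded up, within a fixed factor, to the number
   of points of one of the operators: M k = k.+1 qualifies with kappa = 1, and so
   does any unbounded sequence with bounded ratios M k.+1 / M k.  A constant M
   does not, and with it no accuracy could be guaranteed. *)
Definition roundable (M : nat -> nat) : Prop :=
  exists kappa : nat, forall m, (0 < m)%N ->
    exists k, (m <= M k <= kappa * m)%N.

Definition cost_rate (R : realType) (alpha beta gamma mu eps : R) : R :=
  if mu * gamma < beta then eps `^ (- mu^-1)
  else if beta == mu * gamma then
    eps `^ (- mu^-1) * `|ln eps| `^ (1 + mu^-1)
  else eps `^ (- mu^-1 - (gamma * mu - beta) / (alpha * mu)).

(* Main.v *)
Require Import Defs.
From HB Require Import structures.
From mathcomp Require Import all_boot all_order all_algebra.
From mathcomp Require Import all_classical all_reals all_analysis.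
From mathcomp Require Import measurable_realfun.
From mathcomp Require Import ring lra.

Set Implicit Arguments.
Unset Strict Implicit.
Unset Printing Implicit Defensive.

Import Order.TTheory GRing.Theory Num.Theory.
Import numFieldNormedType.Exports.

Local Open Scope classical_set_scope.
Local Open Scope ring_scope.

(** The error of the multilevel approximation telescopes: on Gamma,
    u - u_K^(ML) = (u - u_{h_K}) + sum_k (d_k - I_{l(K-k)} d_k), where
    d_k = u_{h_k} - u_{h_{k-1}}. By the triangle inequality and the two
    approximation hypotheses its norm is at most
    A eta^(-alpha K) + B sum_k M_{l(K-k)}^(-mu) eta^(-beta k), while the cost is
    at most a constant times sum_k M_{l(K-k)} eta^(gamma k)
    (multilevel_error_le, and the proof of the theorem).

    What remains is an optimization (multilevel_complexity). The depth K is the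
    least one for which the first term is at most eps/2, so that
    eta^(alpha K) <= D / eps (geometric_level). Given K, the ideal real
    numbers of samples x_k, those of least cost for an interpolation error of
    eps/2, come from a Lagrange multiplier: x_k is proportional to
    (eta^(-beta k) / eta^(gamma k))^(1/(1+mu)), and the resulting cost is
    proportional to eps^(-1/mu) S^(1+1/mu), where S is the geometric sum of ratio
    eta^((mu gamma - beta)/(1+mu)) (optimal_allocation). According to the sign of
    mu gamma - beta, S is bounded, equal to K + 1 = O(|log eps|), or
    comparable with its last term, a power of eps; these are the three rates
    (geometric_sum_cost_rate).

    The x_k are rounded up to numbers of points of operators in the given
    sequence, which costs a constant factor and an additional sample per level
    (rounded_allocation). The additional samples cost
    sum_k eta^(gamma k) = O(eps^(-gamma/alpha)), which the assumption
    min(beta, mu gamma) <= alpha absorbs in the rate (sample_sum_cost_rate).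

    The triangle inequality is not immediate. The L^2_rho norm is an integral of a
    pointwise norm that is only almost surely a limit of measurable functions,
    and for the product sigma-algebra, which is not complete, the integral of
    such a function is merely a lower integral, which is superadditive. Removing
    a null set (ge0_integral_setDnull) reduces to measurable functions, to
    which Minkowski's inequality applies (L2rho_norm_triangle). *)

(** * Geometric sums and powers *)

Lemma powR_expE (R : realType) (x s : R) : 0 < x -> x `^ s = expR (s * ln x).
Proof. by move=> x0; rewrite -ln_powR lnK// posrE powR_gt0. Qed.

Lemma powR_expr (R : realType) (x s : R) n : 0 <= x -> (x `^ s) ^+ n = (x ^+ n) `^ s.
Proof.
by move=> x0; rewrite -powR_mulrn ?powR_ge0// -powRrM mulrC powRrM powR_mulrn.
Qed.

Lemma sum_geometric_gt1 (R : realType) (r : R) n : 1 < r ->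
  \sum_(k < n.+1) r ^+ k <= r / (r - 1) * r ^+ n.
Proof.
move=> r1; have r10 : 0 < r - 1 by rewrite subr_gt0.
rewrite mulrAC ler_pdivlMr// mulrC -subrX1 -exprS.
by rewrite lerBlDr lerDl ler01.
Qed.

Lemma sum_geometric_lt1 (R : realType) (r : R) n : 0 <= r < 1 ->
  \sum_(k < n) r ^+ k <= (1 - r)^-1.
Proof.
move=> /andP[r0 r1]; have r10 : 0 < 1 - r by rewrite subr_gt0.
rewrite -[leRHS]mul1r ler_pdivlMr// mulrC -opprB mulNr -subrX1 opprB.
by rewrite lerBlDr lerDl exprn_ge0.
Qed.

(** * Choice of the numbers of samples *)

(** Minimizing the cost sum_k x_k p_k for a prescribed error
    sum_k x_k^(-mu) e_k = tol by a Lagrange multiplier gives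
    x_k proportional to (e_k / p_k)^(1/(1+mu)). With this choice both sums have
    the same shape: the k-th terms are multiples of
    (e_k p_k^mu)^(1/(1+mu)), so that X is determined by S. *)
Lemma optimal_allocation (R : realType) (mu tol : R) (e p : nat -> R) n :
  0 < mu -> 0 < tol -> (forall k, 0 < e k) -> (forall k, 0 < p k) ->
  let S := \sum_(k < n.+1) (e k * p k `^ mu) `^ (1 + mu)^-1 in
  exists2 X : R, 0 < X & let x k := X * (e k / p k) `^ (1 + mu)^-1 in
    \sum_(k < n.+1) x k `^ (- mu) * e k = tol /\
    \sum_(k < n.+1) x k * p k = tol `^ (- mu^-1) * S `^ (1 + mu^-1).
Proof.
move=> mu0 tol0 e0 p0 S.
have mu1 : 1 + mu != 0 by rewrite gt_eqF// addr_gt0.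
have S0 : 0 < S.
  rewrite /S big_ord_recl ltr_pwDl ?powR_gt0 ?mulr_gt0 ?powR_gt0//.
  by apply: sumr_ge0 => i _; exact: powR_ge0.
have X0 : 0 < (S / tol) `^ mu^-1 by apply: powR_gt0; exact: divr_gt0.
(* Both sums equal S up to a factor, X^(-mu) = tol / S and X respectively. *)
exists ((S / tol) `^ mu^-1) => //=; split.
  transitivity (\sum_(k < n.+1) tol / S * (e k * p k `^ mu) `^ (1 + mu)^-1).
    apply: eq_bigr => k _.
    rewrite powRM ?powR_ge0 ?ltW// -!powRrM mulrN mulVf ?gt_eqF//.
    rewrite powR_inv1 ?divr_ge0 ?ltW// invf_div -mulrA; congr (_ * _).
    rewrite !powR_expE ?divr_gt0 ?mulr_gt0 ?expR_gt0//.
    rewrite !lnM ?posrE ?invr_gt0 ?expR_gt0// lnV ?posrE// expRK.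
    rewrite -[X in _ * X]lnK ?posrE// -expRD; congr expR.
    by field.
  by rewrite -mulr_sumr divfK ?gt_eqF.
rewrite (_ : \sum_(k < n.+1) _ = (S / tol) `^ mu^-1 * S); last first.
  rewrite [RHS]mulr_sumr; apply: eq_bigr => k _.
  rewrite -mulrA; congr (_ * _).
  rewrite !powR_expE ?divr_gt0 ?mulr_gt0 ?expR_gt0//.
  rewrite !lnM ?posrE ?invr_gt0 ?expR_gt0// lnV ?posrE// expRK.
  rewrite -[X in _ * X]lnK ?posrE// -expRD; congr expR.
  by field.
rewrite !powR_expE ?divr_gt0//.
rewrite !lnM ?posrE ?invr_gt0// lnV ?posrE//.
rewrite -[X in _ * X]lnK ?posrE// -!expRD; congr expR.
by field; rewrite gt_eqF.
Qed.

(** Choosing the first operator with at least m points makes the choice monotone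
    in m, and since M is monotone it has no more points than any other
    admissible operator. *)
Lemma roundable_argmin (M : nat -> nat) : {homo M : i k / (i <= k)%N} ->
  roundable M -> exists kappa : nat, exists2 g : nat -> nat,
    {homo g : i k / (i <= k)%N} &
    forall m, (0 < m)%N -> (m <= M (g m) <= kappa * m)%N.
Proof.
move=> Mmono [kappa Mr]; exists kappa.
have Mex m : exists k, (m <= M k)%N.
  by have [//|k /andP[mk _]] := Mr m.+1; exists k; exact: ltnW.
exists (fun m => ex_minn (Mex m)).
  move=> m m' mm'; case: ex_minnP => k mk kmin; case: ex_minnP => k' mk' _.
  by apply: kmin; exact: leq_trans mk'.
move=> m m0; case: ex_minnP => k mk kmin; rewrite mk /=.
have [k' /andP[mk' k'm]] := Mr _ m0.
exact/(leq_trans _ k'm)/Mmono/kmin.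
Qed.

(** Each x k is replaced by the first integer above it, at most x k + 1, and then
    by the number of points of the operator provided by g. Since x is
    nonincreasing, levels of larger index get operators of smaller index,
    as the multilevel approximation requires. *)
Lemma rounded_allocation (R : realType) (M : nat -> nat) kappa (g : nat -> nat)
    (mu : R) (x e p : nat -> R) K :
  {homo g : i k / (i <= k)%N} ->
  (forall m, (0 < m)%N -> (m <= M (g m) <= kappa * m)%N) ->
  0 < mu -> (forall k, 0 < x k) -> {homo x : i k / (i <= k)%N >-> k <= i} ->
  (forall k, 0 <= e k) -> (forall k, 0 <= p k) ->
  exists2 l : nat -> nat, {homo l : i k / (i <= k)%N} &
    \sum_(k < K.+1) (M (l (K - k)%N))%:R `^ (- mu) * e k <=
      \sum_(k < K.+1) x k `^ (- mu) * e k /\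
    \sum_(k < K.+1) (M (l (K - k)%N))%:R * p k <=
      kappa%:R * (\sum_(k < K.+1) x k * p k + \sum_(k < K.+1) p k).
Proof.
move=> gmono Mg mu0 x0 xdec e0 p0.
(* The truncated subtraction makes l constant beyond K, hence monotone. *)
exists (fun i => g (Num.truncn (x (K - i)%N)).+1).
  by move=> i k ik; apply: gmono; rewrite ltnS le_truncn// xdec// leq_sub2l.
have Kk (k : 'I_K.+1) : (K - (K - k))%N = k by rewrite subKn// -ltnS.
split.
  apply: ler_sum => k _; rewrite Kk; apply: ler_wpM2r => //.
  have /andP[+ _] := Mg (Num.truncn (x k)).+1 isT.
  rewrite -(ler_nat R) => /(lt_le_trans (truncnS_gt _)) xM.
  rewrite !powRN lef_pV2 ?posrE ?powR_gt0// ?(lt_trans (x0 k))//.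
  by rewrite ge0_ler_powR ?nnegrE ?ltW// (lt_trans (x0 k)).
rewrite -big_split mulr_sumr/=; apply: ler_sum => k _; rewrite Kk.
rewrite -[X in _ * (_ + X)]mul1r -mulrDl mulrA; apply: ler_wpM2r => //.
have /andP[_] := Mg (Num.truncn (x k)).+1 isT.
rewrite -(ler_nat R) natrM => /le_trans; apply; apply: ler_wpM2l => //.
by rewrite -natr1 lerD2r truncn_le ltW.
Qed.

(** The least K with A b^(-K) <= eps exceeds the threshold by a factor b at most,
    unless K = 0; the summand 1 of D accounts for that case. *)
Lemma geometric_level (R : realType) (A b : R) : 0 <= A -> 1 < b ->
  exists2 D : R, 1 <= D & forall eps, 0 < eps < 1 ->
    exists K : nat, A * b ^- K <= eps /\ b ^+ K <= D / eps.
Proof.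
move=> A0 b1; have b0 : 0 < b by rewrite (lt_trans ltr01).
exists (1 + A * b); first by rewrite lerDl mulr_ge0// ltW.
move=> eps /andP[eps0 eps1].
have bex : exists k, A / eps <= b ^+ k.
  have [k _ kP] : exists2 k, True & A / eps <= k%:R * (b - 1).
    exists (Num.truncn (A / eps / (b - 1))).+1 => //.
    by rewrite -ler_pdivrMr ?subr_gt0// ltW// truncnS_gt.
  (* Bernoulli's inequality. *)
  exists k; apply: (le_trans kP); elim: k {kP} => [|k IH].
    by rewrite mul0r ler01.
  rewrite -natr1 mulrDl mul1r exprS.
  rewrite (_ : b * b ^+ k = b ^+ k + (b - 1) * b ^+ k); last by ring.
  rewrite lerD// ler_peMr ?subr_ge0 ?(ltW b1)//.
  by rewrite exprn_ege1// ltW.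
case: (ex_minnP bex) => K AK Kmin; exists K; split.
  by rewrite ler_pdivrMr ?exprn_gt0// mulrC -ler_pdivrMr.
case: K AK Kmin => [|K] AK Kmin.
  by rewrite expr0 ler_pdivlMr// mul1r (le_trans (ltW eps1))// lerDl mulr_ge0// ltW.
have bK : b ^+ K <= A / eps.
  by rewrite leNgt; apply/negP => /ltW/Kmin; rewrite ltnn.
rewrite exprSr (le_trans (ler_wpM2r (ltW b0) bK))// mulrAC.
by apply: ler_wpM2r; rewrite ?invr_ge0 ?(ltW eps0)// lerDr ler01.
Qed.

(** * The three cost rates *)

Section rates.
Variables (R : realType) (q alpha beta gamma mu : R).
Hypotheses (q1 : 1 < q) (alpha0 : 0 < alpha) (gamma0 : 0 < gamma) (mu0 : 0 < mu).

Let q0 : 0 < q. Proof. exact: lt_trans q1. Qed.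

Local Notation rate := (cost_rate alpha beta gamma mu).

Local Notation level D eps K := ((q `^ alpha) ^+ K <= D / eps).

Let powR_gt1 (s : R) : 0 < s -> 1 < q `^ s.
Proof. by move=> s0; rewrite powR_expE// expR_gt1 mulr_gt0// ln_gt0. Qed.

(** At the chosen depth, every exponential of K is a power of eps. *)
Let level_growth (D eps s : R) K : 0 <= s -> 0 < D -> 0 < eps ->
  level D eps K ->
  (q `^ s) ^+ K <= D `^ (s / alpha) * eps `^ (- (s / alpha)).
Proof.
move=> s0 D0 e0 qK.
have -> : D `^ (s / alpha) * eps `^ (- (s / alpha)) = (D / eps) `^ (s / alpha).
  by rewrite powRM ?invr_ge0 ?(ltW D0) ?(ltW e0)// -(powR_inv1 (ltW e0)) -powRrM mulN1r.
have -> : (q `^ s) ^+ K = ((q `^ alpha) ^+ K) `^ (s / alpha).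
  by rewrite -powR_expr ?powR_ge0// -powRrM mulrCA divff ?mulr1// gt_eqF.
apply: ge0_ler_powR => //; first by rewrite divr_ge0// ltW.
  by rewrite nnegrE exprn_ge0// powR_ge0.
by rewrite nnegrE divr_ge0// ltW.
Qed.

Let ler_powRN (eps r s : R) : 0 < eps < 1 -> s <= r -> eps `^ (- s) <= eps `^ (- r).
Proof.
move=> /andP[e0 e1] sr; rewrite !powR_expE// ler_expR !mulNr lerN2.
by apply: ler_wnM2r => //; rewrite ln_le0// ltW.
Qed.

Lemma cost_rate_ge0 eps : 0 <= rate eps.
Proof.
rewrite /cost_rate; case: ifP => _; first exact: powR_ge0.
by case: ifP => _; rewrite ?mulr_ge0 ?powR_ge0.
Qed.

(** The bound exp(-1) on eps serves to absorb additive constants in |log eps|. *)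
Let ge1_ln (eps : R) : 0 < eps < expR (- 1) -> 0 < eps < 1 /\ 1 <= `|ln eps|.
Proof.
move=> /andP[e0 e1].
have l1 : ln eps < -1 by rewrite -[ltRHS]expRK ltr_ln ?posrE ?expR_gt0.
split; last by rewrite ltr0_norm; lra.
by rewrite e0 (lt_trans e1)// expR_lt1; lra.
Qed.

(** The ratio of the geometric sum is less than, equal to or greater than 1
    according as mu gamma is less than, equal to or greater than beta; in these
    cases the sum is respectively O(1), the number of levels, or of the order of
    its last term. *)
Lemma geometric_sum_cost_rate (D : R) : 1 <= D ->
  exists2 c : R, 0 <= c & forall eps K, 0 < eps < expR (- 1) -> level D eps K ->
    eps `^ (- mu^-1) *
      (\sum_(k < K.+1) (q `^ ((mu * gamma - beta) / (1 + mu))) ^+ k) `^ (1 + mu^-1)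
    <= c * rate eps.
Proof.
move=> D1; have D0 : 0 < D by rewrite (lt_le_trans _ D1).
have mu1 : 0 < 1 + mu by rewrite addr_gt0.
have m0 : 0 <= 1 + mu^-1 by rewrite addr_ge0// invr_ge0 ltW.
set t := q `^ (_ / _); have t0 : 0 <= t by exact: powR_ge0.
have T0 K : 0 <= \sum_(k < K) t ^+ k by apply: sumr_ge0 => k _; exact: exprn_ge0.
rewrite /cost_rate; have [mgb|bmg|mgb] := ltgtP (mu * gamma) beta.
- have t1 : t < 1.
    rewrite /t powR_expE// expR_lt1 pmulr_llt0 ?ln_gt0//.
    by rewrite pmulr_llt0 ?invr_gt0// subr_lt0.
  exists ((1 - t)^-1 `^ (1 + mu^-1)); first exact: powR_ge0.
  move=> eps K _ _; rewrite mulrC ler_wpM2r ?powR_ge0//.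
  have := @sum_geometric_lt1 _ t K.+1; rewrite t0 t1 => /(_ isT) tK.
  by apply: ge0_ler_powR; rewrite ?nnegrE// (le_trans _ tK).
- have s0 : 0 < (mu * gamma - beta) / (1 + mu) by rewrite divr_gt0// subr_gt0.
  have t1 : 1 < t by exact: powR_gt1.
  set s := _ / (1 + mu) in t t0 t1 T0 s0 *.
  exists ((t / (t - 1) * D `^ (s / alpha)) `^ (1 + mu^-1)); first exact: powR_ge0.
  move=> eps K /ge1_ln[/andP[e0 e1] _] DK.
  have tt : 0 <= t / (t - 1) by rewrite divr_ge0// subr_ge0 ltW.
  (* By the choice of s, s (1 + 1/mu) / alpha is the additional exponent of the
     rate. *)
  rewrite (_ : - mu^-1 - _ = - mu^-1 + - (s / alpha) * (1 + mu^-1)); last first.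
    by rewrite /s; field; rewrite !gt_eqF.
  rewrite (@powRD _ eps); last by rewrite (gt_eqF e0) implybT.
  rewrite (@powRrM _ eps) [leRHS]mulrCA ler_wpM2l ?powR_ge0//.
  have c0 : 0 <= t / (t - 1) * D `^ (s / alpha) by rewrite mulr_ge0// powR_ge0.
  rewrite -powRM ?powR_ge0//; apply: ge0_ler_powR; rewrite ?nnegrE//.
    by rewrite mulr_ge0// powR_ge0.
  rewrite (le_trans (sum_geometric_gt1 _ t1))// -[leRHS]mulrA ler_wpM2l//.
  by apply: level_growth => //; exact: ltW.
- have t1 : t = 1 by rewrite /t mgb subrr mul0r powRr0.
  have b0 : 0 < ln (q `^ alpha) by rewrite ln_gt0// powR_gt1.
  have c0 : 0 <= (ln D + 1) / ln (q `^ alpha) + 1.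
    by apply: addr_ge0 => //; rewrite divr_ge0 ?(ltW b0)// addr_ge0// ln_ge0.
  exists (((ln D + 1) / ln (q `^ alpha) + 1) `^ (1 + mu^-1)); first exact: powR_ge0.
  move=> eps K /ge1_ln[/andP[e0 e1] l1] DK.
  rewrite mulrCA ler_wpM2l ?powR_ge0// -powRM//.
  apply: ge0_ler_powR; rewrite ?nnegrE ?mulr_ge0//.
  under eq_bigr do rewrite t1 expr1n.
  rewrite sumr_const card_ord -natr1 mulrDl mul1r lerD//.
  rewrite -mulrA [X in _ * X]mulrC mulrA ler_pdivlMr//.
  have -> : K%:R * ln (q `^ alpha) = ln ((q `^ alpha) ^+ K).
    by rewrite lnXn ?powR_gt0// mulr_natl.
  have q0K : 0 < (q `^ alpha) ^+ K by rewrite exprn_gt0// powR_gt0.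
  apply: (@le_trans _ _ (ln (D / eps))); first by rewrite ler_ln ?posrE// divr_gt0.
  rewrite lnM ?posrE ?invr_gt0// lnV ?posrE//.
  rewrite mulrDl mul1r lerD//; first by rewrite ler_peMr ?ln_ge0.
  by rewrite -normrN ler_norm.
Qed.

(** One sample per level costs O(eps^(-gamma/alpha)). For beta >= mu gamma this is
    below eps^(-1/mu) because alpha >= mu gamma; for beta < mu gamma it is below
    the rate because alpha >= beta. *)
Lemma sample_sum_cost_rate (D : R) : Num.min beta (mu * gamma) <= alpha ->
  1 <= D ->
  exists2 c : R, 0 <= c & forall eps K, 0 < eps < expR (- 1) -> level D eps K ->
    \sum_(k < K.+1) (q `^ gamma) ^+ k <= c * rate eps.
Proof.
move=> rates D1; have D0 : 0 < D by rewrite (lt_le_trans _ D1).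
have g1 := powR_gt1 gamma0.
have c0 : 0 <= q `^ gamma / (q `^ gamma - 1).
  by rewrite divr_ge0 ?powR_ge0// subr_ge0 ltW.
exists (q `^ gamma / (q `^ gamma - 1) * D `^ (gamma / alpha)).
  by rewrite mulr_ge0// powR_ge0.
move=> eps K eps01 DK; have [e01 l1] := ge1_ln eps01; have /andP[e0 e1] := e01.
rewrite (le_trans (sum_geometric_gt1 _ g1))// -[leRHS]mulrA ler_wpM2l//.
rewrite (le_trans (level_growth (ltW gamma0) D0 e0 DK))// ler_wpM2l ?powR_ge0//.
have ga : mu * gamma <= alpha -> gamma / alpha <= mu^-1.
  by move=> mga; rewrite ler_pdivrMr// mulrC ler_pdivlMr// mulrC.
move: rates; rewrite /cost_rate.
have [mgb|bmg|mgb] := ltgtP (mu * gamma) beta => rates.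
- exact/ler_powRN/ga.
- rewrite -opprD; apply: ler_powRN => //.
  rewrite -subr_ge0 (_ : _ - _ = (alpha - beta) / (alpha * mu)).
    by rewrite divr_ge0 ?subr_ge0// mulr_ge0 ?ltW.
  by field; rewrite !gt_eqF.
- rewrite -[leLHS]mulr1 ler_pM ?powR_ge0//.
    by apply: ler_powRN => //; apply: ga; rewrite mgb in rates *.
  rewrite -[leLHS](powRr0 `|ln eps|) ler_powR//.
  by rewrite addr_ge0// invr_ge0 ltW.
Qed.

(** The optimization behind the theorem, in terms of numbers only: A q^(-alpha K)
    stands for the finite element error, the two sums for the interpolation
    error and the cost. Half of eps goes to each of the two errors. *)
Lemma multilevel_complexity (M : nat -> nat) (A B : R) :
  {homo M : i k / (i <= k)%N} -> roundable M -> 0 <= A -> 0 < B -> 0 < beta ->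
  Num.min beta (mu * gamma) <= alpha ->
  exists2 c : R, 0 < c & forall eps, 0 < eps < expR (- 1) ->
    exists K : nat, exists l : nat -> nat,
      [/\ {homo l : i k / (i <= k)%N},
          A * (q `^ alpha) ^- K + B * \sum_(k < K.+1)
            (M (l (K - k)%N))%:R `^ (- mu) * (q `^ (- beta)) ^+ k <= eps &
          \sum_(k < K.+1) (M (l (K - k)%N))%:R * (q `^ gamma) ^+ k
            <= c * rate eps].
Proof.
move=> Mmono Mr A0 B0 beta0 rates.
have [kappa [g gmono Mg]] := roundable_argmin Mmono Mr.
have mu1 : 0 < 1 + mu by rewrite addr_gt0.
have [|D D1 levelP] := @geometric_level _ (2 * A) (q `^ alpha) _ (powR_gt1 alpha0).
  by rewrite mulr_ge0.
have [c1 c10 c1P] := geometric_sum_cost_rate D1.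
have [c2 c20 c2P] := sample_sum_cost_rate rates D1.
pose e k := B * (q `^ (- beta)) ^+ k; pose p k := (q `^ gamma) ^+ k.
have e0 k : 0 < e k by rewrite mulr_gt0// exprn_gt0// powR_gt0.
have p0 k : 0 < p k by rewrite exprn_gt0// powR_gt0.
pose b := 2^-1 `^ (- mu^-1) * (B `^ (1 + mu)^-1) `^ (1 + mu^-1).
exists (kappa%:R * (b * c1 + c2) + 1).
  by rewrite ltr_wpDl// mulr_ge0// addr_ge0// !mulr_ge0 ?powR_ge0.
move=> eps eps01; have [e01 _] := ge1_ln eps01; have /andP[eps0 _] := e01.
have [K [AK DK]] := levelP _ e01; exists K.
have [X X0 [Xerr Xcost]] := @optimal_allocation R mu (eps / 2) e p K mu0
  (divr_gt0 eps0 (ltr0Sn _ 1)) e0 p0.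
pose x k := X * (e k / p k) `^ (1 + mu)^-1.
have x0 k : 0 < x k by rewrite mulr_gt0// powR_gt0// divr_gt0.
have xdec : {homo x : i k / (i <= k)%N >-> k <= i}.
  apply/nonincreasing_seqP => k; rewrite ler_wpM2l ?(ltW X0)//.
  have ep0 i : 0 <= e i / p i by rewrite divr_ge0// ltW.
  apply: ge0_ler_powR; rewrite ?nnegrE ?invr_ge0 ?(ltW mu1)// ltW//.
  rewrite ltr_pM ?invr_ge0 ?(ltW (e0 _)) ?(ltW (p0 _))//.
    rewrite /e ltr_pM2l// exprS gtr_pMl ?exprn_gt0 ?powR_gt0//.
    by rewrite powRN invf_lt1 ?powR_gt0// powR_gt1.
  by rewrite ltf_pV2 ?posrE// /p exprS ltr_pMl// powR_gt1.
have [l lmono [lerr lcost]] := @rounded_allocation R M kappa g mu x e p K gmono Mg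
  mu0 x0 xdec (fun k => ltW (e0 k)) (fun k => ltW (p0 k)).
exists l; split => //.
  rewrite [leRHS]splitr lerD//.
    by rewrite ler_pdivlMr// mulrC mulrA.
  rewrite -Xerr (le_trans _ lerr)// mulr_sumr ler_sum// => k _.
  by rewrite /e mulrCA.
apply: (le_trans lcost); rewrite mulrDl mul1r -[leLHS]addr0 lerD ?cost_rate_ge0//.
rewrite -mulrA ler_wpM2l// mulrDl lerD//; last exact: c2P.
rewrite Xcost -mulrA (le_trans _ (ler_wpM2l _ (c1P _ _ eps01 DK)))//; last first.
  by rewrite mulr_ge0 ?powR_ge0.
rewrite (_ : \sum_(k < K.+1) _ = B `^ (1 + mu)^-1 * \sum_(k < K.+1)
    (q `^ ((mu * gamma - beta) / (1 + mu))) ^+ k); last first.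
  rewrite mulr_sumr; apply: eq_bigr => k _.
  rewrite /e /p -mulrA powRM ?mulr_ge0 ?exprn_ge0 ?powR_ge0 ?(ltW B0)//.
  congr (_ * _); rewrite -powR_expr ?powR_ge0// -exprMn -powRrM -powRD.
    rewrite -powR_expr ?powR_ge0// -powRrM; congr ((_ `^ _) ^+ _).
    by ring.
  by rewrite (gt_eqF q0) implybT.
rewrite powRM ?powR_ge0//; last first.
  by apply: sumr_ge0 => k _; rewrite exprn_ge0// powR_ge0.
rewrite (@powRM _ eps) ?(ltW eps0)//.
by rewrite /b [leRHS]mulrACA [X in _ <= X * _]mulrC.
Qed.
End rates.

(** * Integrals of nonnegative functions up to null sets *)

Section lower_integral.
Local Open Scope ereal_scope.
Context d (T : measurableType d) (R : realType).
Variable mu : {measure set T -> \bar R}.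
Import HBNNSimple.

(** The function f need not be measurable: its integral is the supremum of
    those of the simple functions below it, and a simple function can be cut off
    on the null set N without changing its integral. *)
Lemma ge0_integral_setDnull (D N : set T) (f : T -> \bar R) :
  (forall x, 0 <= f x) -> measurable N -> mu N = 0 ->
  \int[mu]_(x in D) f x = \int[mu]_(x in D `\` N) f x.
Proof.
move=> f0 mN N0; rewrite !ge0_integralE//; apply/eqP; rewrite eq_le.
apply/andP; split; last first.
  apply: le_ereal_sup => _ [h hf <-]; exists h => // x.
  apply: (le_trans (hf x)); rewrite !patchE; case: ifPn => [|_].
    by rewrite inE => -[Dx _]; rewrite mem_set.
  by case: ifP.
apply: ge_ereal_sup => _ [h hf <-].
pose h' := mul_nnsfun h (indic_nnsfun R (measurableC mN)).
have h'E x : h' x = (h x * (x \in ~` N)%:R)%R by rewrite /h' /= /mindic indicE.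
apply: ereal_sup_ubound; exists h'.
  move=> x; rewrite h'E patchE; case: ifPn => [|DNx].
    rewrite inE => -[Dx Nx]; rewrite mem_set// mulr1.
    by have := hf x; rewrite patchE mem_set.
  have [Nx|_] := boolP (x \in ~` N); rewrite ?mulr0//= mulr1.
  have := hf x; rewrite patchE; case: ifPn => // Dx.
  by case/negP: DNx; rewrite inE; move: Nx Dx; rewrite !inE.
rewrite -!integralT_nnsfun; apply: ge0_ae_eq_integral => //.
- exact/measurable_EFinP.
- exact/measurable_EFinP.
- by move=> x _; rewrite lee_fin.
- by move=> x _; rewrite lee_fin.
exists N; split => // x /=; apply: contra_notP => Nx _.
by have /= -> := h'E x; rewrite mem_set// mulr1.
Qed.

End lower_integral.

(** * Strong measurability *)

Section strong_measurability.
Variables (R : realType) (N : nat) (rho : 'rV[R]_N -> R).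
Variable E : normedModType R.
Local Notation Y := 'rV[R]_N.
Local Notation simple := (@simple_map R N E setT).
Local Notation smeas := (@strongly_measurable R N rho E setT Num.norm).
Implicit Types (v w : Y -> E).

Lemma simple_map_lin (a : R) v w :
  simple v -> simple w -> simple (fun y => a *: v y + w y).
Proof.
move=> [m [A [b [mA _ vE]]]] [n [B [c [mB _ wE]]]].
exists (m + n)%N, (fun i => match fintype.split i with inl j => A j | inr k => B k end),
  (fun i => match fintype.split i with inl j => a *: b j | inr k => c k end).
split => // [i|y]; first by case: fintype.split.
rewrite vE wE big_split_ord/= scaler_sumr; congr (_ + _).
  apply: eq_bigr => i _; rewrite -[lshift n i]/(unsplit (inl i)) unsplitK.
  by rewrite !scalerA mulrC.
by apply: eq_bigr => i _; rewrite -[rshift m i]/(unsplit (inr i)) unsplitK.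
Qed.

Lemma measurable_norm_simple v : simple v -> measurable_fun setT (fun y => `|v y|).
Proof.
move=> [m [A [b [mA _ /funext ->]]]].
(* The constant x makes an induction on the number of sets possible: on
   and off the first set, its term is absorbed in x. *)
suff H : forall n (B : 'I_n -> set Y) (c : 'I_n -> E) (x : E),
    (forall i, measurable (B i)) -> measurable_fun setT
      (fun y => `|x + \sum_i (\1_(B i) y : R) *: c i|).
  by under eq_fun do rewrite -[X in `|X|]add0r; exact: H.
elim=> [|n IH] B c x mB.
  by under eq_fun do rewrite big_ord0 addr0; exact: measurable_cst.
pose F z := fun y => `|z + \sum_(i < n)
  (\1_(B (lift ord0 i)) y : R) *: c (lift ord0 i)|.
have mF z : measurable_fun setT (F z) by apply: IH.
have -> : (fun y => `|x + \sum_i (\1_(B i) y : R) *: c i|) =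
    (\1_(B ord0) \* (F (x + c ord0) \- F x) \+ F x).
  apply/funext => y /=; rewrite big_ord_recl indicE.
  case: (y \in B ord0); first by rewrite scale1r mul1r subrK addrA.
  by rewrite scale0r add0r mul0r add0r.
apply: measurable_funD => //; apply: measurable_funM; last exact: measurable_funB.
exact: measurable_indic.
Qed.

Lemma strongly_measurable_lin (a : R) v w :
  smeas v -> smeas w -> smeas (fun y => a *: v y + w y).
Proof.
move=> [s [ss sv]] [t [st tw]].
exists (fun n y => a *: s n y + t n y); split => [n|]; first exact: simple_map_lin.
move: sv tw; rewrite /almost_surely; apply: filterS2 => y sv tw Gy ry.
have {}sv := sv Gy ry; have {}tw := tw Gy ry.
have cv : (fun n => `|a| * `|s n y - v y| + `|t n y - w y|) @ \oo --> (0 : R).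
  rewrite -[X in _ --> X](addr0 0) -[X in X + _](mulr0 `|a|).
  by apply: cvgD => //; apply: cvgM => //; exact: cvg_cst.
apply: (squeeze_cvgr _ (cvg_cst 0) cv); near=> n.
rewrite normr_ge0/= opprD addrACA -scalerBr (le_trans (ler_normD _ _))//.
by rewrite normrZ.
Unshelve. all: by end_near. Qed.

Lemma strongly_measurableB v w : smeas v -> smeas w -> smeas (fun y => v y - w y).
Proof.
move=> sv sw; have := strongly_measurable_lin (-1) sw sv.
by under eq_fun do rewrite scaleN1r addrC.
Qed.

Lemma strongly_measurable0 : smeas (fun=> 0).
Proof.
exists (fun _ _ => 0); split => [n|].
  exists 0%N, (fun _ => set0), (fun _ => 0); split => // y.
  by rewrite big_ord0.
rewrite /almost_surely; apply: nearW => y _ _; rewrite subrr normr0; exact: cvg_cst.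
Qed.

Lemma strongly_measurable_sum n (v : 'I_n -> Y -> E) : (forall i, smeas (v i)) ->
  smeas (fun y => \sum_i v i y).
Proof.
elim: n v => [|n IH] v sv.
  by under eq_fun do rewrite big_ord0; exact: strongly_measurable0.
under eq_fun do rewrite big_ord_recl -[X in X + _]scale1r.
by apply: strongly_measurable_lin => //; exact: IH.
Qed.

Lemma strongly_measurable_eq v w : (forall y, @Gamma R N y -> v y = w y) ->
  smeas v -> smeas w.
Proof.
move=> vw [s [ss sv]]; exists s; split => //.
by move: sv; rewrite /almost_surely; apply: filterS => y sv Gy ry; rewrite -vw//; exact: sv.
Qed.

Lemma strongly_measurableZ (phi : Y -> R) (x : E) :
  @strongly_measurable R N rho R setT Num.norm phi ->
  smeas (fun y => phi y *: x).
Proof.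
move=> [s [ss sphi]]; exists (fun n y => s n y *: x); split => [n|].
  have [m [A [b [mA _ sE]]]] := ss n; exists m, A, (fun i => b i *: x).
  split => // y; rewrite sE scaler_suml; apply: eq_bigr => i _.
  by rewrite scalerA.
move: sphi; rewrite /almost_surely; apply: filterS => y sphi Gy ry.
rewrite -[X in _ --> X](mul0r `|x|).
under eq_fun do rewrite -scalerBl normrZ.
by apply: cvgM; [exact: sphi|exact: cvg_cst].
Qed.

End strong_measurability.

(** * The triangle inequality in L^2_rho *)

Section L2rho_triangle.
Variables (R : realType) (N : nat) (rho : 'rV[R]_N -> R).
Hypotheses (rho_ge0 : forall y, 0 <= rho y) (mrho : measurable_fun setT rho).
Variable E : normedModType R.
Local Notation Y := 'rV[R]_N.
Local Notation mu := (@lebesgue_rV R N).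
Local Notation smeas := (@strongly_measurable R N rho E setT Num.norm).
Implicit Types (v w : Y -> E) (Z : set Y).

(** Almost sure statements constrain nothing where rho vanishes, so that norms
    can be expected to be measurable only on this set, for a suitable null set
    Z. *)
Let supp Z : set Y := [set y | Gamma y /\ 0 < rho y] `\` Z.

(** The function whose plain L^2 norm is the L^2_rho norm of v. *)
Let weighted Z v : Y -> R := fun y => `|v y| * \1_(supp Z) y * Num.sqrt (rho y).

Let measurable_supp Z : measurable Z -> measurable (supp Z).
Proof.
move=> mZ; apply: measurableD => //.
rewrite (_ : [set y | _] = (\bigcap_(n in [set: 'I_N]) (rV_coord n @^-1` `[-1, 1]))
    `&` ([set: Y] `&` rho @^-1` `]0, +oo[)).
  apply: measurableI; last by apply: mrho.
  apply: fin_bigcap_measurable => // n _.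
  by rewrite -[X in measurable X]setTI; apply: measurable_rV_coord.
apply/seteqP; split => y /=; rewrite in_itv/= andbT.
  by move=> [Gy ry]; split => // n _ /=; rewrite in_itv/=; exact: Gy.
by move=> [Gy [_ ry]]; split => // n; have := Gy n I; rewrite /= in_itv.
Qed.

Let measurable_weighted Z Z' v : measurable Z -> measurable Z' -> Z `<=` Z' ->
  measurable_fun setT (fun y => `|v y| * \1_(supp Z) y) ->
  measurable_fun setT (weighted Z' v).
Proof.
move=> mZ mZ' ZZ' mv; rewrite /weighted.
have -> : (fun y => `|v y| * \1_(supp Z') y * Num.sqrt (rho y)) =
    ((fun y => `|v y| * \1_(supp Z) y) \* \1_(supp Z') \* (Num.sqrt \o rho)).
  apply/funext => y /=; congr (_ * _); rewrite -mulrA; congr (_ * _).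
  rewrite -[RHS]/((\1_(supp Z) \* \1_(supp Z')) y) -indicI; congr (\1_ _ _).
  apply/seteqP; split => [z [Pz nz]|z []//].
  by split; split => // /ZZ'.
apply: measurable_funM; last first.
  exact: (measurableT_comp (continuous_measurable_fun (@sqrt_continuous R)) mrho).
by apply: measurable_funM => //; apply: measurable_indic; exact: measurable_supp.
Qed.

(** With Z containing the points where the approximating simple maps fail to
    converge, the truncated norms of the latter converge everywhere. *)
Let strongly_measurable_weighted v : smeas v ->
  exists Z, [/\ measurable Z, mu Z = 0%E &
    measurable_fun setT (fun y => `|v y| * \1_(supp Z) y)].
Proof.
move=> [s [ss [Z [mZ Z0 sv]]]]; exists Z; split => //.
apply: (@measurable_fun_cvg _ _ _ _ (fun n y => `|s n y| * \1_(supp Z) y)).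
  move=> n; apply: measurable_funM; first exact: measurable_norm_simple.
  by apply: measurable_indic; exact: measurable_supp.
move=> y _; rewrite indicE; case: (boolP (y \in supp Z)) => [|_]; last first.
  by under eq_fun do rewrite mulr0; rewrite mulr0; exact: cvg_cst.
rewrite inE => -[[Gy ry] nZy]; rewrite mulr1.
under eq_fun do rewrite mulr1.
have {}sv : (fun n => `|s n y - v y|) @ \oo --> (0 : R).
  by apply: contrapT => nsv; apply: nZy; apply: sv => /(_ Gy ry).
apply: cvg_norm; apply: cvg_sub0 (cvg_cst (v y)).
exact/norm_cvg0P.
Qed.

(** For any null set Z: the integrand of the L^2_rho norm vanishes where rho does,
    and the null set does not affect the lower integral. *)
Let L2rho_normE v Z : measurable Z -> mu Z = 0%E ->
  L2rho_norm rho v = 'N[mu]_2%:E[EFin \o weighted Z v]%E.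
Proof.
move=> mZ Z0; rewrite unlock /L2rho_norm /L2rho_norm_of; congr (_ `^ _)%E.
rewrite [LHS]integral_mkcond.
rewrite [LHS](@ge0_integral_setDnull _ _ _ mu setT Z)//; last first.
  by move=> y; apply: erestrict_ge0 => {}y _; rewrite lee_fin mulr_ge0// sqr_ge0.
rewrite [LHS]integral_mkcond; apply: eq_integral => y _.
transitivity (`|weighted Z v y| ^+ 2)%:E; last by rewrite -powR_mulrn.
rewrite setTD !patchE /weighted indicE.
rewrite normrM exprMn [X in _ * X ^+ 2]ger0_norm ?sqrtr_ge0// sqr_sqrtr//.
rewrite normrM normr_id.
have [Zy|Zy] := pselect (Z y).
  by rewrite !memNset ?normr0 ?mulr0 ?expr0n ?mul0r//= => -[].
rewrite [y \in ~` Z]mem_set//.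
have [Gy|Gy] := pselect (Gamma y); last first.
  by rewrite (memNset Gy) memNset ?normr0 ?mulr0 ?expr0n ?mul0r//= => -[[]].
rewrite mem_set//; have := rho_ge0 y; rewrite le_eqVlt => /predU1P[<-|ry].
  by rewrite !mulr0.
by rewrite mem_set//= normr1 mulr1.
Qed.

Let measurable_null_weighted v : smeas v ->
  exists Z, [/\ measurable Z, mu Z = 0%E & forall Z', measurable Z' -> Z `<=` Z' ->
    measurable_fun setT (weighted Z' v)].
Proof.
move=> /strongly_measurable_weighted[Z [mZ Z0 mv]]; exists Z; split => // Z' mZ' ZZ'.
exact: measurable_weighted mv.
Qed.

(** Minkowski's inequality for the weighted norms, with one null set that makes
    those of v, w and v + w all measurable. *)
Lemma L2rho_norm_triangle v w : smeas v -> smeas w ->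
  (L2rho_norm rho (fun y => v y + w y)%R <= L2rho_norm rho v + L2rho_norm rho w)%E.
Proof.
move=> sv sw.
have svw : smeas (fun y => v y + w y).
  have := strongly_measurable_lin 1 sv sw.
  by under eq_fun do rewrite scale1r.
have [Z1 [mZ1 Z10 mv]] := measurable_null_weighted sv.
have [Z2 [mZ2 Z20 mw]] := measurable_null_weighted sw.
have [Z3 [mZ3 Z30 mvw]] := measurable_null_weighted svw.
pose Z := Z1 `|` Z2 `|` Z3.
have mZ : measurable Z by apply: measurableU => //; exact: measurableU.
have Z0 : mu Z = 0%E.
  by rewrite !measureU0//; exact: measurableU.
have {}mv : measurable_fun setT (weighted Z v) by apply: mv => // y; left; left.
have {}mw : measurable_fun setT (weighted Z w) by apply: mw => // y; left; right.
have {}mvw : measurable_fun setT (weighted Z (fun y => v y + w y)).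
  by apply: mvw => // y; right.
rewrite !(L2rho_normE _ mZ Z0).
apply: (le_trans _ (minkowski_EFin mu mv mw (ler1n R 2))).
have pow_mono (x y : \bar R) (r : R) : 0 <= r -> (0 <= x)%E -> (x <= y)%E ->
    (x `^ r <= y `^ r)%E.
  move=> r0 x0 xy; apply: gt0_ler_poweR => //; rewrite in_itv/= ?x0 ?leey//.
  by rewrite (le_trans x0 xy).
have mpow (F : Y -> R) : measurable_fun setT F ->
    measurable_fun setT (fun y => (`|(F y)%:E| `^ 2)%E).
  move=> mF; apply: (measurableT_comp (measurable_poweR 2)).
  by apply: measurableT_comp => //; exact/measurable_EFinP.
rewrite unlock; apply: (pow_mono) => //.
  by apply: integral_ge0 => y _; exact: poweR_ge0.
apply: ge0_le_integral => //.
- by move=> y _; exact: poweR_ge0.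
- exact: mpow.
- by apply: mpow; exact: measurable_funD.
move=> y _; apply: (pow_mono) => //=.
rewrite lee_fin /weighted -!mulrDl !normrM !normr_id.
rewrite -!mulrA ler_wpM2r//.
by rewrite [leRHS]ger0_norm ?addr_ge0// ler_normD.
Qed.

End L2rho_triangle.

(** * The joint density *)

Lemma joint_density_ge0 (R : realType) N (rho1 : R -> R) (y : 'rV[R]_N) :
  probability_density rho1 -> 0 <= joint_density rho1 y.
Proof. by move=> [r0 _ _]; apply: prodr_ge0 => n _; exact: r0. Qed.

Lemma measurable_joint_density (R : realType) N (rho1 : R -> R) :
  probability_density rho1 -> measurable_fun setT (@joint_density R N rho1).
Proof.
move=> [_ mr _]; apply: measurable_prod => n _.
exact: (measurableT_comp mr (measurable_rV_coord n)).
Qed.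

(** * The error of the multilevel approximation *)

Section multilevel_error.
Variables (R : realType) (N : nat) (rho : 'rV[R]_N -> R) (E : normedModType R).
Local Notation Y := 'rV[R]_N.
Local Notation smeas := (@strongly_measurable R N rho E setT Num.norm).
Implicit Types v w : Y -> E.

Lemma L2rho_norm_eq v w : (forall y, @Gamma R N y -> v y = w y) ->
  L2rho_norm rho v = L2rho_norm rho w.
Proof.
move=> vw; rewrite /L2rho_norm /L2rho_norm_of; congr (_ `^ _)%E.
by apply: eq_integral => y; rewrite inE => Gy; rewrite vw.
Qed.

(** The nodes lie in Gamma. This allows passing from u_{h_k} to the element of
    Lambda that agrees with it on Gamma. *)
Lemma interp_eq M (I : interpolation R N M) v w : interpolation_operator rho I ->
  (forall y, @Gamma R N y -> v y = w y) -> interp I v = interp I w.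
Proof.
move=> [GI _ _] vw; apply/funext => y; apply: eq_bigr => m _; congr (_ *: _).
by apply: eq_bigr => l _; rewrite vw.
Qed.

Lemma strongly_measurable_interp M (I : interpolation R N M) v :
  interpolation_operator rho I -> smeas (interp I v).
Proof.
move=> [_ LI _]; apply: strongly_measurable_sum => m.
by apply: strongly_measurableZ; have [] := LI m.
Qed.

Hypotheses (rho_ge0 : forall y, 0 <= rho y) (mrho : measurable_fun setT rho).

Lemma L2rho_norm_sum n (v : 'I_n -> Y -> E) : (forall i, smeas (v i)) ->
  (L2rho_norm rho (fun y => \sum_i v i y)%R <= \sum_i L2rho_norm rho (v i))%E.
Proof.
elim: n v => [|n IH] v sv.
  under eq_fun do rewrite big_ord0.
  rewrite big_ord0 /L2rho_norm /L2rho_norm_of.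
  under eq_integral do rewrite normr0 expr0n mul0r.
  by rewrite integral0 poweR_EFin powR0// invr_neq0.
under eq_fun do rewrite big_ord_recl.
rewrite big_ord_recl; apply: le_trans (L2rho_norm_triangle _ _ _ _) _ => //.
  exact: strongly_measurable_sum.
by rewrite leeD2l// IH.
Qed.

Variables (u : Y -> E) (uh : nat -> Y -> E) (M : nat -> nat).
Variable I : forall k, interpolation R N (M k).
Hypotheses (su : smeas u) (suh : forall k, smeas (uh k)).
Hypothesis hI : forall k, interpolation_operator rho (I k).

Lemma sum_level_difference K y :
  \sum_(k < K.+1) level_difference uh k y = uh K y.
Proof.
elim: K => [|K IH]; first by rewrite big_ord1 /level_difference subr0.
by rewrite big_ord_recr/= IH /level_difference addrC subrK.
Qed.

Lemma strongly_measurable_level_difference k : smeas (level_difference uh k).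
Proof.
rewrite /level_difference; case: k => [|k]; last exact: strongly_measurableB.
by under eq_fun do rewrite subr0.
Qed.

(** Since the level differences add up to uh K, the multilevel approximation
    differs from uh K by the interpolation errors of the differences. *)
Lemma multilevel_error_le l K :
  (multilevel_error rho u uh I l K <=
     L2rho_norm rho (fun y => u y - uh K y)%R +
     \sum_(k < K.+1) L2rho_norm rho (fun y => level_difference uh k y -
       interp (I (l (K - k)%N)) (level_difference uh k) y)%R)%E.
Proof.
rewrite /multilevel_error.
have sd (k : 'I_K.+1) : smeas (fun y => level_difference uh k y -
    interp (I (l (K - k)%N)) (level_difference uh k) y).
  apply: strongly_measurableB; first exact: strongly_measurable_level_difference.
  exact: strongly_measurable_interp.
have -> : (fun y => u y - multilevel uh I l K y) = (fun y => (u y - uh K y) +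
    \sum_(k < K.+1) (level_difference uh k y -
       interp (I (l (K - k)%N)) (level_difference uh k) y)).
  apply/funext => y; rewrite sumrB sum_level_difference.
  by rewrite addrA subrK.
apply: le_trans (L2rho_norm_triangle _ _ _ _) _ => //.
- exact: strongly_measurableB.
- exact: strongly_measurable_sum.
by rewrite leeD2l// L2rho_norm_sum.
Qed.

End multilevel_error.
(** * Convergence and cost of the multilevel method *)

Theorem theorem4p2 (R : realType) (d N : nat) (D : set 'rV[R]_d)
  (rho1 : R -> R) (rho : 'rV[R]_N -> R)
  (a : 'rV[R]_N -> 'rV[R]_d -> R) (amin amax : R)
  (f : 'rV[R]_N -> H10 D -> R) (u : 'rV[R]_N -> H10 D)
  (* spatial discretization *)
  (eta : nat) (h : nat -> R) (TT : nat -> seq (simplex R d))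
  (V : nat -> set (H10 D)) (uh : nat -> 'rV[R]_N -> H10 D)
  (* interpolation operators and costs *)
  (M : nat -> nat) (I : forall k, interpolation R N (M k)) (C : nat -> R)
  (* constants and data of the convergence and cost assumptions *)
  (alpha Cs CI Czeta beta mu gamma Cc : R)
  (Lambda : completeNormedModType R)
  (j : {linear Lambda -> ('rV[R]_N -> H10 D)}) (w : nat -> Lambda)
  (zeta : Lambda -> R) (sigma : nat -> R)
  (* boundary value problem *)
  (hd : (0 < d <= 3)%N) (hN : (0 < N)%N)
  (hD : bounded_lipschitz_domain D)
  (hrho1 : probability_density rho1)
  (hrho : rho = joint_density rho1)
  (hrho_bnd : essentially_bounded rho)
  (hamin : 0 < amin)
  (ha_meas : almost_surely rho (fun y => measurable_fun D (a y)))
  (ha : almost_surely rho (fun y =>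
          forall x, closure D x -> amin <= a y x <= amax))
  (hf : L2rho_of rho (@dual_space R d D) (@dual_norm R d D) f)
  (hu_L2 : L2rho rho u)
  (hu : variational_solution rho setT a f u)
  (hu_cont : {within @Gamma R N, continuous u})
  (* finite element spaces and Galerkin approximations *)
  (heta : (1 < eta)%N) (hh0 : 0 < h 0%N)
  (hh : forall k, h k = eta%:R ^- k * h 0%N)
  (hTT : forall k, triangulation D (TT k))
  (hTT_reg : shape_regular TT)
  (hTT_mesh : forall k, mesh_size (TT k) (h k))
  (hTT_ref : forall k, refines (TT k.+1) (TT k))
  (hV : forall k, fe_space (TT k) (V k))
  (hV_nested : forall k, V k `<=` V k.+1)
  (huh : forall k, variational_solution rho (V k) a f (uh k))
  (* interpolation operators *)
  (hM : forall k, (0 < M k)%N)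
  (hI : forall k, interpolation_operator rho (I k))
  (hM_round : roundable M)
  (hC : forall k, 0 <= C k)
  (* finite element error *)
  (halpha : 0 < alpha) (hCs : 0 < Cs)
  (hi : forall k, (L2rho_norm rho (fun y => u y - uh k y)%R
                     <= (Cs * h k `^ alpha)%:E)%E)
  (* interpolation error on the Banach space Lambda *)
  (hCI : 0 < CI) (hCzeta : 0 < Czeta) (hbeta : 0 < beta) (hmu : 0 < mu)
  (hj_L2 : forall v, L2rho rho (j v))
  (hj_inj : forall v, L2rho_norm rho (j v) = 0%E -> v = 0)
  (hw : forall k y, Gamma y -> j (w k) y = uh k y)
  (hii : forall v k, (L2rho_norm rho (fun y => j v y - interp (I k) (j v) y)%R
                        <= (CI * sigma k * zeta v)%:E)%E)
  (hsigma_decr : forall k, sigma k.+1 <= sigma k)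
  (hzeta : forall k, zeta (w k) <= Czeta * h 0%N `^ beta)
  (hzeta_diff : forall k, zeta (w k.+1 - w k) <= Czeta * h k.+1 `^ beta)
  (hsigma : forall k, sigma k = (M k)%:R `^ (- mu))
  (* cost per sample *)
  (hgamma : 0 < gamma) (hCc : 0 < Cc)
  (hiii : forall k, C k <= Cc * h k `^ (- gamma))
  (hrates : Num.min beta (mu * gamma) <= alpha) :
  exists2 c : R, 0 < c &
    forall eps : R, 0 < eps < expR (- 1) ->
      exists K : nat, exists l : nat -> nat,
        [/\ {homo l : i k / (i <= k)%N},
            (multilevel_error rho u uh I l K <= eps%:E)%E,
            multilevel_cost M C l K <= c * cost_rate alpha beta gamma mu eps &
            (eps_cost rho u uh I C eps
               <= (c * cost_rate alpha beta gamma mu eps)%:E)%E].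
Proof.
have rho_ge0 y : 0 <= rho y by rewrite hrho joint_density_ge0.
have mrho : measurable_fun setT rho by rewrite hrho; exact: measurable_joint_density.
have eta0 : 0 < eta%:R :> R by rewrite ltr0n (ltn_trans _ heta).
have hpow k s : h k `^ s = h 0%N `^ s * (eta%:R `^ (- s)) ^+ k.
  rewrite hh powRM ?invr_ge0 ?exprn_ge0 ?(ltW eta0) ?(ltW hh0)//.
  rewrite mulrC -exprVn -powR_expr ?invr_ge0 ?(ltW eta0)//; congr (_ * _ ^+ _).
  by rewrite -(powR_inv1 (ltW eta0)) -powRrM mulN1r.
have Mmono : {homo M : i k / (i <= k)%N}.
  apply: homo_leq => // [|k]; first exact: leq_trans.
  have := hsigma_decr k; rewrite !hsigma !powRN lef_pV2 ?posrE ?powR_gt0 ?ltr0n//.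
  rewrite -(ler_nat R) leNgt => Mk; rewrite leNgt; apply: contra Mk => Mk.
  by rewrite gt0_ltr_powR// nnegrE.
(* All powers of h k become geometric in k, with the powers of h 0 as factors. *)
have [|||c c0 cP] := @multilevel_complexity R eta%:R alpha beta gamma mu _ halpha
  hgamma hmu M (Cs * h 0%N `^ alpha) (CI * Czeta * h 0%N `^ beta) Mmono hM_round
  _ _ hbeta hrates.
- by rewrite ltr1n.
- by rewrite mulr_ge0 ?powR_ge0 ?ltW.
- by rewrite !mulr_gt0 ?powR_gt0.
have G0 : 0 < Cc * h 0%N `^ (- gamma) by rewrite mulr_gt0 ?powR_gt0.
exists (Cc * h 0%N `^ (- gamma) * c); first exact: mulr_gt0.
move=> eps eps01; have [K [l [lmono lerr lcost]]] := cP _ eps01.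
have cost_le : multilevel_cost M C l K <=
    Cc * h 0%N `^ (- gamma) * c * cost_rate alpha beta gamma mu eps.
  rewrite -mulrA (le_trans _ (ler_wpM2l (ltW G0) lcost))// mulr_sumr ler_sum// => k _.
  rewrite mulrCA ler_wpM2l// (le_trans (hiii k))// hpow opprK mulrA.
  exact: lexx.
(* uh k agrees on Gamma with an element of Lambda, hence is measurable. *)
have suh k : @strongly_measurable R N rho (H10 D) setT Num.norm (uh k).
  by have [_ + _] := hj_L2 (w k); apply: strongly_measurable_eq; exact: hw.
have [_ su _] := hu_L2.
pose dw k := if k is k'.+1 then w k'.+1 - w k' else w 0%N.
have dwE k y : Gamma y -> level_difference uh k y = j (dw k) y.
  move=> Gy; rewrite /level_difference /dw; case: k => [|k].
    by rewrite subr0 hw.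
  by rewrite linearB /= -!hw.
have zdw k : zeta (dw k) <= Czeta * h k `^ beta.
  by case: k => [|k]; [exact: hzeta|exact: hzeta_diff].
have err_le : (multilevel_error rho u uh I l K <= eps%:E)%E.
  apply: (le_trans (multilevel_error_le rho_ge0 mrho su suh hI l K)).
  apply: (@le_trans _ _ ((Cs * h K `^ alpha)%:E + \sum_(k < K.+1)
      (CI * (M (l (K - k)%N))%:R `^ (- mu) * (Czeta * h k `^ beta))%:E)%E).
    apply: leeD => //; apply: lee_sum => k _.
    rewrite (@L2rho_norm_eq _ _ _ _ _ (fun y => j (dw k) y -
        interp (I (l (K - k)%N)) (j (dw k)) y)); last first.
      by move=> y Gy; rewrite dwE// (interp_eq (hI _) (@dwE k)).
    apply: (le_trans (hii _ _)); rewrite lee_fin hsigma ler_wpM2l//.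
    by rewrite mulr_ge0 ?powR_ge0 ?ltW.
  rewrite sumEFin -EFinD lee_fin (le_trans _ lerr)// lerD//.
    by rewrite hpow mulrA powRN exprVn.
  rewrite mulr_sumr ler_sum// => k _; rewrite hpow.
  by rewrite [leLHS](_ : _ = CI * Czeta * h 0%N `^ beta *
    ((M (l (K - k)%N))%:R `^ (- mu) * (eta%:R `^ (- beta)) ^+ k))//; ring.
exists K, l; split => //.
apply: (@le_trans _ _ (multilevel_cost M C l K)%:E); last by rewrite lee_fin.
by apply: ereal_inf_lbound; exists l, K.
Qed.
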